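(* Let $K$ be a (nonempty) compact Hausdorff space, let $E$ be a separable USD-nonfriendly Banach space and let $W$ be a Banach space. If $T_n: C(K,E)\to W$, $n\in\mathbb{N}$, are narrow operators such that for every $f\in C(K,E)$ the series $\sum_{n=1}^\infty T_nf$ converges unconditionally in $W$, then the sum operator $T: C(K,E)\to W$, $Tf=\sum_{n=1}^\infty T_nf$, is narrow.
   Context: Banach spaces are real and ''operator'' means bounded linear operator between Banach spaces. $B(X)$ is the closed unit ball and $S(X)$ the unit sphere of a Banach space $X$. $C(K,E)$ is the space of continuous functions $K\to E$ with the sup-norm. An operator $T: X\to Z$ is narrow if for every $x,y\in S(X)$, every $x^*\in X^*$ and every $\varepsilon>0$ there is $u\in B(X)$ with $\|x+u\|>2-\varepsilon$ and $\|T(y-u)\|+|x^*(y-u)|<\varepsilon$. For $x,y\in E$ and $\varepsilon>0$ put $D(x,y,\varepsilon)=\{z\in E:\|x+y+z\|>2-\varepsilon,\ \|y+z\|<1+\varepsilon\}$ and $\mathcal{D}(E)=\{D(x,y,\varepsilon): x,y\in S(E),\ \varepsilon>0\}$. A Banach space $E$ is USD-nonfriendly if there exists $\alpha>0$ such that every closed absolutely convex (i.e. nonempty, convex and balanced) subset $A\subset E$ which intersects every element of $\mathcal{D}(E)$ contains $\alpha B(E)$. *)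

(* Defs.v *)
From HB Require Import structures.
From mathcomp Require Import all_boot all_order all_algebra.
From mathcomp Require Import all_classical all_reals all_analysis.
From mathcomp Require Import lra.

Set Implicit Arguments.
Unset Strict Implicit.
Unset Printing Implicit Defensive.

Import Order.TTheory GRing.Theory Num.Theory.
Import numFieldNormedType.Exports.

Local Open Scope classical_set_scope.
Local Open Scope ring_scope.

(* C(K, E). The proof [cK] of compactness is a parameter of the type because the
   sup-norm is a norm only on bounded functions. *)
Definition ctsfun (R : realType) (K : topologicalType)
    (cK : compact [set: K]) (E : completeNormedModType R) : Type :=
  continuousType K E.

Section ctsfun_banach.
Context {R : realType} {K : topologicalType} (cK : compact [set: K]).
Context {E : completeNormedModType R}.
Local Notation C := (ctsfun cK E).
Implicit Types (f g h : C) (x : K).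

HB.instance Definition _ := Choice.copy C (continuousType K E).

Definition ctsfun_of (f : K -> E) (cf : continuous f) : C :=
  (mkcts cf : continuousType K E).

Lemma ctsfun_continuous f : continuous f.
Proof. exact: (@cts_fun _ _ (f : continuousType K E)). Qed.

Lemma ctsfunP f g : f = g <-> f =1 g.
Proof. exact: continuousEP. Qed.

Let zero_cts : continuous (fun _ : K => 0 : E).
Proof. by move=> x; exact: cvg_cst. Qed.

Let opp_cts f : continuous (fun x => - f x).
Proof. by move=> x; apply: cvgN; exact: ctsfun_continuous. Qed.

Let add_cts f g : continuous (fun x => f x + g x).
Proof. by move=> x; apply: cvgD; exact: ctsfun_continuous. Qed.

Let scale_cts (a : R) f : continuous (fun x => a *: f x).
Proof. by move=> x; apply: cvgZl_tmp; exact: ctsfun_continuous. Qed.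

Definition ctsfun_zero : C := ctsfun_of zero_cts.
Definition ctsfun_opp f : C := ctsfun_of (@opp_cts f).
Definition ctsfun_add f g : C := ctsfun_of (@add_cts f g).
Definition ctsfun_scale (a : R) f : C := ctsfun_of (@scale_cts a f).

Let addA : associative ctsfun_add.
Proof. by move=> f g h; apply/ctsfunP => x; exact: addrA. Qed.

Let addC : commutative ctsfun_add.
Proof. by move=> f g; apply/ctsfunP => x; exact: addrC. Qed.

Let add0 : left_id ctsfun_zero ctsfun_add.
Proof. by move=> f; apply/ctsfunP => x; exact: add0r. Qed.

Let addN : left_inverse ctsfun_zero ctsfun_opp ctsfun_add.
Proof. by move=> f; apply/ctsfunP => x; exact: addNr. Qed.

HB.instance Definition _ := GRing.isZmodule.Build C addA addC add0 addN.

Let scaleA (a b : R) f :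
  ctsfun_scale a (ctsfun_scale b f) = ctsfun_scale (a * b) f.
Proof. by apply/ctsfunP => x; exact: scalerA. Qed.

Let scale1 : left_id (1 : R) ctsfun_scale.
Proof. by move=> f; apply/ctsfunP => x; exact: scale1r. Qed.

Let scaleDr : right_distributive ctsfun_scale +%R.
Proof. by move=> a f g; apply/ctsfunP => x; exact: scalerDr. Qed.

Let scaleDl f : {morph ctsfun_scale^~ f : a b / a + b}.
Proof. by move=> a b; apply/ctsfunP => x; exact: scalerDl. Qed.

HB.instance Definition _ :=
  GRing.Zmodule_isLmodule.Build R C scaleA scale1 scaleDr scaleDl.

Definition ctsfun_norm f : R := sup (range (fun x => `|f x|)).

Lemma ctsfun_has_ubound f : has_ubound (range (fun x => `|f x|)).
Proof.
have /compact_bounded/pinfty_ex_gt0[M _ Mf] : compact (range (f : K -> E)).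
  by apply: continuous_compact => //; apply: continuous_subspaceT;
    exact: ctsfun_continuous.
by exists M => _ [x _ <-]; apply: Mf; exists x.
Qed.

Lemma ctsfun_norm_ub f x : `|f x| <= ctsfun_norm f.
Proof. by apply: ub_le_sup; [exact: ctsfun_has_ubound|exists x]. Qed.

Lemma ctsfun_norm_ge0 f : 0 <= ctsfun_norm f.
Proof.
have [[x _]|/nonemptyPn K0] := pselect ([set: K] !=set0).
  exact: le_trans (ctsfun_norm_ub f x).
by rewrite /ctsfun_norm K0 image_set0 sup0.
Qed.

Lemma ctsfun_norm_le f (M : R) :
  0 <= M -> (forall x, `|f x| <= M) -> ctsfun_norm f <= M.
Proof.
move=> M0 fM; have [[x _]|/nonemptyPn K0] := pselect ([set: K] !=set0).
  by apply: ge_sup; [exists `|f x|, x|move=> _ [y _ <-]].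
by rewrite /ctsfun_norm K0 image_set0 sup0.
Qed.

Let normD f g : ctsfun_norm (f + g) <= ctsfun_norm f + ctsfun_norm g.
Proof.
apply: ctsfun_norm_le => [|x]; first by rewrite addr_ge0 ?ctsfun_norm_ge0.
by apply: le_trans (ler_normD _ _) _; rewrite lerD ?ctsfun_norm_ub.
Qed.

Let normZ (a : R) f : ctsfun_norm (a *: f) = `|a| * ctsfun_norm f.
Proof.
have le_normZ (b : R) g : ctsfun_norm (b *: g) <= `|b| * ctsfun_norm g.
  apply: ctsfun_norm_le => [|x]; first by rewrite mulr_ge0 ?ctsfun_norm_ge0.
  by rewrite [leLHS]normrZ ler_wpM2l ?ctsfun_norm_ub.
have [->|a0] := eqVneq a 0.
  rewrite normr0 mul0r; apply/eqP; rewrite eq_le ctsfun_norm_ge0 andbT.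
  by apply: le_trans (le_normZ _ _) _; rewrite normr0 mul0r.
apply/eqP; rewrite eq_le le_normZ /= -ler_pdivlMl ?normr_gt0//.
by rewrite -normfV -[X in ctsfun_norm X <= _](scalerK a0) le_normZ.
Qed.

Let norm0_eq0 f : ctsfun_norm f = 0 -> f = 0.
Proof.
move=> f0; apply/ctsfunP => x; apply/eqP.
by rewrite -[_ == _]normr_le0 -f0 ctsfun_norm_ub.
Qed.

HB.instance Definition _ :=
  Lmodule_isNormed.Build R C normD normZ norm0_eq0.

Lemma ctsfun_normE f : `|f| = sup (range (fun x => `|f x|)).
Proof. by []. Qed.

Let ctsfun_complete (F : set_system C) : ProperFilter F -> cauchy F -> cvg F.
Proof.
move=> FF /cauchyP Fc.
have evalF x : cauchy ((fun f : C => f x) @ F).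
  apply: cauchy_exP => e e0; have [f Ff] := Fc _ e0; exists (f x).
  rewrite /nbhs/=; apply: filterS Ff => g.
  rewrite -!ball_normE/=; apply: le_lt_trans; exact: (ctsfun_norm_ub (f - g)).
pose g x : E := lim ((fun f : C => f x) @ F).
have gP x : (fun f : C => f x) @ F --> g x by apply: cauchy_cvg; exact: evalF.
have close e : 0 < e -> exists2 f : C, F (ball f e) &
    forall x, `|g x - f x| <= e.
  move=> e0; have [f Ff] := Fc _ e0; exists f => // x.
  rewrite distrC.
  apply: (@closed_cvg _ _ F _ (fun h : C => h x) [set z | `|f x - z| <= e]);
    last exact: gP.
    have := @closed_ball_closed R E (f x) e.
    by rewrite closed_ballE.
  apply: filterS Ff => h; rewrite -ball_normE/= => /ltW.
  exact: le_trans (ctsfun_norm_ub (f - h) x).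
have cg : continuous g.
  move=> x; apply/cvgrPdist_lt => e e0.
  have e30 : 0 < e / 3 by rewrite divr_gt0.
  have [f _ fg] := close _ e30.
  have /cvgrPdist_lt/(_ _ e30) := @ctsfun_continuous f x.
  apply: filterS => y fxy.
  rewrite (_ : g x - g y = (g x - f x) + (f x - f y) + (f y - g y)); last first.
    by rewrite addrA [_ + (f x - _)]addrA !subrK.
  apply: le_lt_trans (ler_normD _ _) _.
  apply: le_lt_trans (lerD (ler_normD _ _) (lexx _)) _.
  rewrite [`|f y - g y|]distrC.
  apply: (@lt_le_trans _ _ (e / 3 + e / 3 + e / 3)).
    by rewrite ltr_leD// ler_ltD.
  by lra.
apply/cvg_ex; exists (ctsfun_of cg).
apply/cvgrPdist_le => e e0.
have e20 : 0 < e / 2 by rewrite divr_gt0.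
have [f Ff fg] := close _ e20.
near=> h; apply: ctsfun_norm_le => [|x]; first exact: ltW.
rewrite [e]splitr.
have -> : (ctsfun_of cg - h) x = (g x - f x) + (f x - h x).
  by rewrite addrA subrK.
apply: le_trans (ler_normD _ _) _; rewrite lerD//.
apply: le_trans (ctsfun_norm_ub (f - h) x) _; apply: ltW.
have : ball f (e / 2) h by near: h.
by rewrite -ball_normE.
Unshelve. all: by end_near. Qed.

HB.instance Definition _ := Uniform_isComplete.Build C ctsfun_complete.

End ctsfun_banach.

Section banach.
Context {R : realType}.

(* For linear maps, [bounded_near] at 0 means that T maps some neighborhood
   of 0 to a bounded set (see [linear_boundedP], [linear_bounded_continuous]). *)
Definition bounded_operator (X Z : normedModType R) (T : X -> Z) : Prop :=
  linear T /\ bounded_near T (nbhs (0 : X)).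

Definition unit_ball (X : normedModType R) : set X := [set x | `|x| <= 1].

Definition unit_sphere (X : normedModType R) : set X := [set x | `|x| = 1].

Definition narrow (X Z : completeNormedModType R) (T : X -> Z) : Prop :=
  bounded_operator T /\
  forall (x y : X) (xs : X -> R^o) (e : R),
    unit_sphere x -> unit_sphere y -> bounded_operator xs -> 0 < e ->
    exists u : X, [/\ unit_ball u, `|x + u| > 2 - e &
      `|T (y - u)| + `|xs (y - u)| < e].

Definition D_set (E : normedModType R) (x y : E) (e : R) : set E :=
  [set z | `|x + y + z| > 2 - e /\ `|y + z| < 1 + e].

Definition D_family (E : normedModType R) : set (set E) :=
  [set D | exists x y e,
    [/\ unit_sphere x, unit_sphere y, 0 < e & D = D_set x y e]].

Definition balanced (E : normedModType R) (A : set E) : Prop :=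
  forall (a : R) (x : E), `|a| <= 1 -> A x -> A (a *: x).

Definition absolutely_convex (E : normedModType R) (A : set E) : Prop :=
  [/\ A !=set0, convex_set A & balanced A].

Definition usd_nonfriendly (E : completeNormedModType R) : Prop :=
  exists2 alpha : R, 0 < alpha &
    forall A : set E, closed A -> absolutely_convex A ->
      (forall D, D_family D -> A `&` D !=set0) ->
      [set alpha *: x | x in @unit_ball E] `<=` A.

(* Every rearrangement of the series converges. *)
Definition unconditionally_cvg (W : normedModType R) (a : nat -> W) : Prop :=
  forall s : nat -> nat, bijective s -> cvgn (series (a \o s)).

End banach.

Definition separable (T : topologicalType) : Prop :=
  exists2 S : set T, countable S & dense S.

(* Main.v *)
Require Import Defs.
From HB Require Import structures.
From mathcomp Require Import all_boot all_order all_algebra.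
From mathcomp Require Import all_classical all_reals all_analysis.
From mathcomp Require Import ring lra.

Set Implicit Arguments.
Unset Strict Implicit.
Unset Printing Implicit Defensive.

Import Order.TTheory GRing.Theory Num.Theory.
Import numFieldNormedType.Exports.

Local Open Scope classical_set_scope.
Local Open Scope ring_scope.

(* Call a continuous seminorm p on C(K,E) C-narrow if for every v in E every
   nonempty open set supports a bump function phi with p (phi v) small.

   Narrow operators give C-narrow seminorms.  Inside an open set U, iterate the
   narrowness condition: if u is close to h modulo p, replace u by the vector y
   near a point where |x + u| is almost 2, and continue with the new function.
   The differences telescope, so the average of the n modifications is small
   for p, vanishes off U, and takes a value in D(x,y,e).  As E is separable, a
   Baire argument finds one point of U where the values of such functions meet
   all the sets D(x,y,e).  The closure of these values is absolutely convex, so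
   it contains a ball by nonfriendliness.

   For the sum T of the T_n, choose bumps phi_1, phi_2, ... such that phi_(k+1)
   is supported where phi_k = 1, and increasing cuts n_k such that T_i (phi_k v)
   is negligible except for i in the k-th block [n_k, n_(k+1)).  The sum of the
   block contributions is then close to the sum of +-T_i applied to
   (phi_1 - phi_2 + phi_3 - ...) v, which is bounded independently of the number
   of bumps, since the alternating sum lies between 0 and 1 and the signed partial
   sums are uniformly bounded.  Dividing by the number of bumps makes T small on
   the average of the phi_k v. *)

(** * Equalities of linear combinations *)

Section linear_combination.
Context {R : comPzRingType} {V : lmodType R}.

Inductive lincomb :=
  | LAtom of nat | LZero | LAdd of lincomb & lincomb
  | LOpp of lincomb | LScale of R & lincomb.

Fixpoint lincomb_eval (s : seq V) (e : lincomb) : V :=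
  match e with
  | LAtom i => s`_i
  | LZero => 0
  | LAdd e1 e2 => lincomb_eval s e1 + lincomb_eval s e2
  | LOpp e1 => - lincomb_eval s e1
  | LScale a e1 => a *: lincomb_eval s e1
  end.

Fixpoint lincomb_coef (e : lincomb) (i : nat) : R :=
  match e with
  | LAtom j => if j == i then 1 else 0
  | LZero => 0
  | LAdd e1 e2 => lincomb_coef e1 i + lincomb_coef e2 i
  | LOpp e1 => - lincomb_coef e1 i
  | LScale a e1 => a * lincomb_coef e1 i
  end.

Lemma lincomb_evalE s e :
  lincomb_eval s e = \sum_(i < size s) lincomb_coef e i *: s`_i.
Proof.
elim: e => [j||e1 IH1 e2 IH2|e1 IH1|a e1 IH1] /=.
- have [js|sj] := ltnP j (size s).
    rewrite (bigD1 (Ordinal js))//= eqxx scale1r big1 ?addr0// => i ij.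
    by rewrite ifN ?scale0r// eq_sym.
  rewrite nth_default// big1// => i _; rewrite ifN ?scale0r//.
  by rewrite neq_ltn (leq_trans (ltn_ord i) sj) orbT.
- by rewrite big1// => i _; rewrite scale0r.
- by rewrite IH1 IH2 -big_split/=; apply: eq_bigr => i _; rewrite scalerDl.
- by rewrite IH1 -sumrN; apply: eq_bigr => i _; rewrite scaleNr.
- by rewrite IH1 scaler_sumr; apply: eq_bigr => i _; rewrite scalerA.
Qed.

(** On a concrete list of atoms the [foldr] hypothesis computes to one scalar equation per atom,
    which [ring] or [field] can settle. *)
Lemma lincomb_eq s e1 e2 :
  foldr (fun i P => lincomb_coef e1 i = lincomb_coef e2 i /\ P) True
    (iota 0 (size s)) ->
  lincomb_eval s e1 = lincomb_eval s e2.
Proof.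
move=> e12; rewrite !lincomb_evalE; apply: eq_bigr => i _; congr (_ *: _).
have : nat_of_ord i \in iota 0 (size s) by rewrite mem_iota/=.
elim: (iota 0 _) e12 => //= j r IH [ej er]; rewrite in_cons => /orP[/eqP->//|].
exact: IH.
Qed.

End linear_combination.

Ltac lincomb_atoms t s :=
  lazymatch t with
  | (?a + ?b)%R => let s' := lincomb_atoms a s in lincomb_atoms b s'
  | (- ?a)%R => lincomb_atoms a s
  | (_ *: ?a)%R => lincomb_atoms a s
  | 0%R => s
  | _ => match s with context [cons t _] => s | _ => constr:(cons t s) end
  end.

Ltac lincomb_index t s :=
  lazymatch s with
  | cons t _ => constr:(0%N)
  | cons _ ?s' => let n := lincomb_index t s' in constr:(S n)
  end.

Ltac lincomb_reify R t s :=
  lazymatch t with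
  | (?a + ?b)%R => let a' := lincomb_reify R a s in
     let b' := lincomb_reify R b s in constr:(@LAdd R a' b')
  | (- ?a)%R => let a' := lincomb_reify R a s in constr:(@LOpp R a')
  | (?c *: ?a)%R => let a' := lincomb_reify R a s in constr:(@LScale R c a')
  | 0%R => constr:(@LZero R)
  | _ => let i := lincomb_index t s in constr:(@LAtom R i)
  end.

(* Proves an equality of linear combinations in a module over [R] by comparing
   the coefficients of each atom. *)
Ltac lmodule R :=
  lazymatch goal with
  | |- @eq ?T ?a ?b =>
    let s := lincomb_atoms a (@nil T) in
    let s := lincomb_atoms b s in
    let ea := lincomb_reify R a s in
    let eb := lincomb_reify R b s in
    refine (@lincomb_eq R _ s ea eb _); cbn -[GRing.add GRing.opp GRing.mul
      GRing.one GRing.zero GRing.natmul GRing.inv];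
    repeat (split; [try solve [reflexivity | ring | field]|]); try exact Logic.I
  end.

(** * Seminorms, operators and bump functions *)

Lemma exists_nat_gt (R : realType) (a : R) :
  exists2 n : nat, a < n%:R & (0 < n)%N.
Proof. by exists (Num.truncn a).+1 => //; exact: truncnS_gt. Qed.

Section seminorm.
Context {R : realType} {X : normedModType R}.
Implicit Types (p q : X -> R) (f g : X).

(** Continuity is encoded as domination by a multiple of the norm. Seminorms, unlike operators with
    different targets, can be added: the functional in [narrow] and finitely many [T_ i] are thus
    treated together. *)
Definition continuous_seminorm p :=
  [/\ forall f g, p (f + g) <= p f + p g,
      forall (a : R) f, p (a *: f) = `|a| * p f &
      exists2 c : R, 0 <= c & forall f, p f <= c * `|f|].

Lemma seminormN p f : continuous_seminorm p -> p (- f) = p f.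
Proof. by case=> _ pZ _; rewrite -scaleN1r pZ normrN1 mul1r. Qed.

Lemma seminorm0 p : continuous_seminorm p -> p 0 = 0.
Proof. by case=> _ pZ _; rewrite -(scale0r 0) pZ normr0 mul0r. Qed.

Lemma seminormB p f g : continuous_seminorm p -> p (f - g) <= p f + p g.
Proof. by move=> sp; rewrite -(seminormN g sp); case: sp. Qed.

Lemma seminorm_ge0 p f : continuous_seminorm p -> 0 <= p f.
Proof.
move=> sp; have := seminormB f f sp.
by rewrite subrr seminorm0// -mulr2n pmulrn_lge0.
Qed.

Lemma continuous_seminormD p q :
  continuous_seminorm p -> continuous_seminorm q ->
  continuous_seminorm (fun f => p f + q f).
Proof.
move=> [pD pZ [c c0 pc]] [qD qZ [d d0 qd]]; split.
- by move=> f g; rewrite addrACA lerD.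
- by move=> a f; rewrite pZ qZ mulrDr.
- by exists (c + d) => [|f]; rewrite ?addr_ge0// mulrDl lerD.
Qed.

Lemma continuous_seminorm0 : continuous_seminorm (fun=> 0).
Proof.
split=> [f g|a f|]; first by rewrite addr0.
  by rewrite mulr0.
by exists 0 => // f; rewrite mul0r.
Qed.

Lemma operator_bound (Z : normedModType R) (T : X -> Z) :
  bounded_operator T -> exists2 c, 0 < c & forall f, `|T f| <= c * `|f|.
Proof.
move=> [lT bT]; pose T' : {linear X -> Z} :=
  HB.pack T (GRing.isLinear.Build _ _ _ _ _ lT).
have /linear_boundedP/pinfty_ex_gt0[c c0 Tc] : bounded_near T' (nbhs 0) by [].
by exists c.
Qed.

Lemma operatorD (Z : normedModType R) (T : X -> Z) f g :
  linear T -> T (f + g) = T f + T g.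
Proof. by move=> lT; have := lT 1 f g; rewrite !scale1r. Qed.

Lemma operator0 (Z : normedModType R) (T : X -> Z) : linear T -> T 0 = 0.
Proof.
by move=> lT; have /eqP := operatorD 0 0 lT; rewrite addr0 -subr_eq0 opprD
  addrA subrr sub0r oppr_eq0 => /eqP.
Qed.

Lemma operatorZ (Z : normedModType R) (T : X -> Z) a f :
  linear T -> T (a *: f) = a *: T f.
Proof. by move=> lT; have := lT a f 0; rewrite (operator0 lT) !addr0. Qed.

Lemma operator_seminorm (Z : normedModType R) (T : X -> Z) :
  bounded_operator T -> continuous_seminorm (fun f => `|T f|).
Proof.
move=> bT; have [c c0 Tc] := operator_bound bT; case: bT => lT _; split.
- by move=> f g; rewrite operatorD// ler_normD.
- by move=> a f; rewrite operatorZ// normrZ.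
- by exists c => //; exact: ltW.
Qed.

End seminorm.

Section function_module.
Context {R : realType} {K : topologicalType} (cK : compact [set: K]).
Context {E : completeNormedModType R}.
Local Notation X := (ctsfun cK E).
Local Notation CK := (ctsfun cK R^o).
Implicit Types (f g : X) (phi psi : CK) (t : K) (U V : set K).

Lemma ctsfunD f g t : (f + g) t = f t + g t. Proof. by []. Qed.
Lemma ctsfunB f g t : (f - g) t = f t - g t. Proof. by []. Qed.
Lemma ctsfunZ (a : R) f t : (a *: f) t = a *: f t. Proof. by []. Qed.
Lemma ctsfun0 t : (0 : X) t = 0. Proof. by []. Qed.

Lemma ctsfun_ub f t : `|f t| <= `|f|.
Proof. exact: ctsfun_norm_ub. Qed.

Lemma ctsfun_le f (M : R) : 0 <= M -> (forall t, `|f t| <= M) -> `|f| <= M.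
Proof. exact: ctsfun_norm_le. Qed.

Lemma ctsfun_gtP f (M : R) : 0 <= M -> M < `|f| -> exists t, M < `|f t|.
Proof.
move=> M0; apply: contraPP => /forallNP fM; apply/negP; rewrite -leNgt.
by apply: ctsfun_le => // t; rewrite leNgt; exact/negP/fM.
Qed.

Lemma ctsfun_open f (v : E) (e : R) : open [set t | `|f t - v| < e].
Proof.
apply: (@open_comp _ _ (f : K -> E) [set z | `|z - v| < e]).
  by move=> t _; exact: ctsfun_continuous.
have -> : [set z | `|z - v| < e] = ball v e.
  by apply/seteqP; split=> z; rewrite -ball_normE/= distrC.
exact: ball_open.
Qed.

Lemma cst_cts (v : E) : continuous (fun _ : K => v).
Proof. by move=> t; exact: cvg_cst. Qed.

Definition ctsfun_cst (v : E) : X := ctsfun_of cK (@cst_cts v).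

Lemma ctsfun_cstE v t : ctsfun_cst v t = v. Proof. by []. Qed.

Lemma smul_cts phi f : continuous (fun t => phi t *: f t).
Proof. by move=> t; apply: cvgZ; exact: ctsfun_continuous. Qed.

Definition ctsfun_smul phi f : X := ctsfun_of cK (@smul_cts phi f).

Lemma ctsfun_smulE phi f t : ctsfun_smul phi f t = (phi t : R) *: f t.
Proof. by []. Qed.

End function_module.

Notation "phi ** f" := (ctsfun_smul phi f)
  (at level 40, left associativity) : ring_scope.

Section bump.
Context {R : realType} {K : topologicalType} (cK : compact [set: K]).
Local Notation CK := (ctsfun cK (R^o : completeNormedModType R)).
Implicit Types (phi psi : CK) (t : K) (U V : set K).

Definition bump U V phi :=
  [/\ forall t, 0 <= (phi t : R) <= 1, forall t, ~ U t -> phi t = 0 :> R &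
      forall t, V t -> phi t = 1 :> R].

(** Regularity gives a neighborhood [A] of [t] whose closure lies in [U]; Urysohn's lemma then
    separates [closure A] from the complement of [U]. *)
Lemma exists_bump (hK : hausdorff_space K) U t : open U -> U t ->
  exists V phi, [/\ open V, V t & bump U V phi].
Proof.
move=> oU Ut.
have Unbhs : nbhs t U by exact: open_nbhs_nbhs.
have [A /= nA clAU] : filter_from (nbhs t) closure U.
  exact: (@compact_regular K t setT hK cK filterT).
have sep : uniform_separator (~` U) (closure A).
  apply: (@normal_uniform_separator K (compact_normal hK cK)).
  - exact: open_closedC.
  - exact: closed_closure.
  - by apply/disjoints_subset; exact: subsetC.
have [phi [cphi phi01 phi0 phi1]] := (@uniform_separatorP K R _ _).1 sep.
exists A°, (ctsfun_of cK (cphi : continuous (phi : K -> R^o))); split.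
- exact: open_interior.
- by [].
split=> s.
- by have := phi01 (phi s) (ex_intro2 _ _ s I erefl); rewrite /= in_itv.
- by move=> Us; apply: phi0; exists s.
- move=> /interior_subset/subset_closure As; apply: phi1; exists s => //.
Qed.

End bump.

(** * The strong Daugavet condition on an open set *)

Section strong_daugavet.
Context {R : realType}.

(** With [xs] fixed and p(f) = |T f| + |xs f|, this is the approximation clause of [narrow]. *)
Definition strong_daugavet (X : normedModType R) (p : X -> R) :=
  forall (x y : X) (e : R), unit_sphere x -> unit_sphere y -> 0 < e ->
  exists u : X, [/\ unit_ball u, `|x + u| > 2 - e & p (y - u) < e].

(** The triangle inequality, after subtracting (N - 1) u from N (x + u) if N >= 1, or (1 - N) x from
    x + u otherwise. The loss is N e in the first case and e in the second; (N + 1) e covers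
    both. *)
Lemma norm_scaleD_ge (E : normedModType R) (x u : E) (N e : R) :
  `|x| <= 1 -> `|u| <= 1 -> 0 <= N -> 0 <= e -> 2 - e <= `|x + u| ->
  N + 1 - (N + 1) * e <= `|N *: x + u|.
Proof.
move=> x1 u1 N0 e0 xu; have [N1|N1] := leP 1 N.
  have : N * (2 - e) <= `|N *: x + u| + (N - 1).
    apply: (@le_trans _ _ `|N *: (x + u)|).
      by rewrite normrZ ger0_norm// ler_wpM2l.
    have -> : N *: (x + u) = (N *: x + u) + (N - 1) *: u.
      by lmodule R.
    apply: le_trans (ler_normD _ _) _; rewrite lerD2l normrZ.
    by rewrite [`|N - 1|]ger0_norm ?subr_ge0// ler_piMr// subr_ge0.
  by move=> ?; nra.
have : 2 - e <= `|N *: x + u| + (1 - N).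
  apply: le_trans xu _.
  have -> : x + u = (N *: x + u) + (1 - N) *: x.
    by lmodule R.
  apply: le_trans (ler_normD _ _) _; rewrite lerD2l normrZ.
  have N1' : 0 <= 1 - N by rewrite subr_ge0 ltW.
  by rewrite ger0_norm// ler_piMr.
by move=> ?; nra.
Qed.

Context {K : topologicalType} (cK : compact [set: K]).
Context (hK : hausdorff_space K) {E : completeNormedModType R}.
Local Notation X := (ctsfun cK E).
Local Notation CK := (ctsfun cK (R^o : completeNormedModType R)).
Implicit Types (f g : X) (phi psi : CK) (t : K) (U V : set K).

Lemma bump_sub U V phi : bump U V phi -> V `<=` U.
Proof.
move=> [_ phi0 phi1] t Vt; apply: contrapT => Ut.
by have := phi0 _ Ut; rewrite phi1// => /eqP; rewrite oner_eq0.
Qed.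

Lemma norm_bump_smul U V phi (v : E) :
  bump U V phi -> V !=set0 -> `|phi ** ctsfun_cst cK v| = `|v|.
Proof.
move=> [phi01 _ phi1] [t Vt]; apply/eqP; rewrite eq_le; apply/andP; split.
  apply: ctsfun_le => // s; have /andP[s0 s1] := phi01 s.
  by rewrite ctsfun_smulE normrZ ger0_norm// ler_piMl.
apply: le_trans (ctsfun_ub _ t).
by rewrite ctsfun_smulE phi1// scale1r.
Qed.

Context (p : X -> R) (sp : continuous_seminorm p) (dp : strong_daugavet p).

(* [w] approximates the sum of the functions [u] obtained so far, [h] is the
   current function, and [- G] is the sum of the modifications. *)
Lemma daugavet_chain U (x y : E) : open U -> U !=set0 ->
  `|x| = 1 -> `|y| = 1 -> forall (n : nat) (d : R), 0 < d -> d < 1 ->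
  exists V (h G : X) (w : E),
    [/\ [/\ open V, V !=set0 & V `<=` U],
        [/\ `|h| <= 1 & forall t, V t -> h t = y],
        [/\ forall t, ~ U t -> G t = 0, `|G| <= 2 * n%:R &
            forall t, V t -> `|G t + n%:R *: y - w| <= d],
        [/\ `|w| <= n%:R & n%:R + 1 - d <= `|x + w|] &
        p (G + h - ctsfun_cst cK y) <= d].
Proof.
move=> oU U0 x1 y1; elim=> [|n IH] d d0 d1.
  exists U, (ctsfun_cst cK y), 0, 0; split.
  - by split.
  - by split=> //; apply: ctsfun_le => // t; rewrite ctsfun_cstE y1.
  - split=> //; first by rewrite normr0 mulr0.
    by move=> t _; rewrite ctsfun0 scale0r subr0 addr0 normr0 ltW.
  - by rewrite normr0 addr0 x1; split=> //; lra.
  - by rewrite add0r subrr seminorm0// ltW.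
have [||V [h [G [w [[oV V0 VU] [h1 hV] [GU Gn GV] [wn xw] pG]]]]] :=
  IH (d / 2); [by lra|by lra|].
have n0 : 0 <= n%:R :> R by [].
set N := `|x + w| in xw.
have Npos : 0 < N by lra.
have Nn : N <= n%:R + 1.
  by apply: le_trans (ler_normD _ _) _; rewrite x1 addrC lerD2r.
(* The Daugavet condition is applied to a bump inside [V] times the direction of [x + w]. This
   forces the almost extremal point into [V] and makes the norm of [x + w] grow by almost 1 when the
   value of [u] there is added. *)
pose x' := N^-1 *: (x + w).
have Nx' : N *: x' = x + w by rewrite scalerA mulfV ?scale1r ?gt_eqF.
have x'1 : `|x'| = 1.
  by rewrite normrZ ger0_norm ?invr_ge0 ?ltW// mulVf ?gt_eqF.
have [t1 Vt1] := V0.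
have [V1 [phi [oV1 V1t1 bphi]]] := exists_bump (R := R) cK hK oV Vt1.
have g1 : unit_sphere (phi ** ctsfun_cst cK x').
  by rewrite /unit_sphere/= (norm_bump_smul _ bphi)//; exists t1.
have hs : unit_sphere h.
  apply/eqP; rewrite eq_le h1 -y1 -(hV t1)//=; exact: ctsfun_ub.
(* Since N + 1 <= n + 2, the norm loses at most (N + 1) 2 eta <= d / 2 in this step; the other half
   of [d] is spent by the induction hypothesis. *)
pose eta := d / (4 * (n%:R + 2)).
have etaE : (n%:R + 2) * eta = d / 4.
  by rewrite /eta; field; rewrite gt_eqF//; lra.
have eta0 : 0 < eta by apply: divr_gt0 => //; lra.
have eta4 : eta <= d / 4 by rewrite -etaE; nra.
have [u [u1 gu pu]] := dp g1 hs eta0.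
have [|t] := ctsfun_gtP _ gu; first by lra.
have ut1 s : `|u s| <= 1 by exact: le_trans (ctsfun_ub _ _) u1.
rewrite ctsfunD ctsfun_smulE => gut.
have [phi01 phi0 phi1] := bphi; have /andP[phit0 phit1] := phi01 t.
have phit : 1 - phi t <= eta.
  have := lt_le_trans gut (ler_normD _ _).
  by rewrite normrZ x'1 mulr1 ger0_norm//; have := ut1 t; lra.
have Vt : V t by apply: contrapT => /phi0 E0; lra.
have x'u : 2 - 2 * eta <= `|x' + u t|.
  have : 2 - eta <= `|x' + u t| + (1 - phi t).
    apply: le_trans (ltW gut) _.
    have -> : phi t *: x' + u t = (x' + u t) - (1 - phi t) *: x'.
      by lmodule R.
    apply: le_trans (ler_normB _ _) _.
    by rewrite lerD2l normrZ x'1 mulr1 ger0_norm//; lra.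
  by lra.
pose V2 := V `&` [set s | `|u s - u t| < d / 4].
have oV2 : open V2 by apply: openI => //; exact: ctsfun_open.
have V2t : V2 t by split => //=; rewrite subrr normr0; lra.
have [V3 [psi [oV3 V3t bpsi]]] := exists_bump (R := R) cK hK oV2 V2t.
have [psi01 psi0 psi1] := bpsi; have V32 := bump_sub bpsi.
(* Adding [D] makes [u] equal to [y] on [V3] and keeps it in the unit ball, being a pointwise convex
   combination of [u] and [y]. As [D] is also subtracted from [G], the sum of [G] and the current
   function changes only by [u - h], which is small for [p]. *)
pose D := psi ** (ctsfun_cst cK y - u).
have DE s : D s = psi s *: (y - u s) by [].
exists V3, (u + D), (G - D), (w + u t); split.
- split => //; first by exists t.
  by move=> s /V32[/VU].
- split.
    apply: ctsfun_le => // s; have /andP[s0 s1] := psi01 s.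
    have -> : (u + D) s = (1 - psi s) *: u s + psi s *: y.
      by rewrite ctsfunD DE; lmodule R.
    apply: le_trans (ler_normD _ _) _.
    rewrite !normrZ y1 mulr1 !ger0_norm// ?subr_ge0//.
    by have := ut1 s; nra.
  by move=> s V3s; rewrite ctsfunD DE psi1// scale1r addrC subrK.
- split.
  + move=> s Us; rewrite ctsfunB GU// DE psi0 ?scale0r ?subrr//.
    by move=> [/VU].
  + apply: le_trans (ler_normB _ _) _.
    rewrite -[n.+1%:R]natr1 mulrDr mulr1 lerD//.
    apply: ctsfun_le => // s; have /andP[s0 s1] := psi01 s.
    rewrite DE normrZ ger0_norm//.
    have := ler_normB y (u s); have := ut1 s.
    by have := normr_ge0 (y - u s); nra.
  + move=> s V3s; have [Vs /= us] := V32 _ V3s.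
    have -> : (G - D) s + n.+1%:R *: y - (w + u t) =
        (G s + n%:R *: y - w) + (u s - u t).
      by rewrite ctsfunB DE psi1//; lmodule R.
    apply: le_trans (ler_normD _ _) _.
    by have := GV _ Vs; lra.
- split.
    by apply: le_trans (ler_normD _ _) _; rewrite -[n.+1%:R]natr1 lerD.
  have := norm_scaleD_ge (N := N) _ (ut1 t) _ _ x'u.
  rewrite x'1 Nx' addrA -[n.+1%:R]natr1.
  move=> /(_ (lexx _) (ltW Npos)) /(_ _)/wrap[|].
    by lra.
  apply: le_trans.
  have : (N + 1) * (2 * eta) <= d / 2 by nra.
  by lra.
- have -> : G - D + (u + D) - ctsfun_cst cK y =
      (G + h - ctsfun_cst cK y) - (h - u).
    by lmodule R.
  by apply: le_trans (seminormB _ _ sp) _; lra.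
Qed.

End strong_daugavet.

Section localize.
Context {R : realType} {K : topologicalType} (cK : compact [set: K]).
Context (hK : hausdorff_space K) {E : completeNormedModType R}.
Local Notation X := (ctsfun cK E).
Context (p : X -> R) (sp : continuous_seminorm p) (dp : strong_daugavet p).

(** Take F = G / n for a chain of length n. The chain bounds p(G) by d + 2 c whatever n is, so p(F)
    is small for large n, while y + F(t) is within [d] of w / n, a vector of norm at most 1 that is
    almost additive with [x]. *)
Lemma daugavet_localize (U : set K) (x y : E) (e : R) :
  open U -> U !=set0 -> `|x| = 1 -> `|y| = 1 -> 0 < e ->
  exists (F : X) (t : K), [/\ forall s, ~ U s -> F s = 0, `|F| <= 2,
    p F < e, U t & D_set x y e (F t)].
Proof.
move=> oU U0 x1 y1 e0; have [pD pZ [c c0 pc]] := sp.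
have [d [d0 d1 de]] : exists d : R, [/\ 0 < d, d < 1 & 2 * d < e].
  exists (e / (2 * (e + 1))); split.
  - by apply: divr_gt0 => //; lra.
  - by rewrite ltr_pdivrMr; lra.
  - by rewrite mulrA ltr_pdivrMr; [nra|lra].
have [n nlt n0] := exists_nat_gt ((d + 2 * c) / e).
have [V [h [G [w [[oV [t Vt] VU] [h1 hV] [GU Gn GV] [wn xw] pG]]]]] :=
  daugavet_chain hK sp dp oU U0 x1 y1 n d0 d1.
have nR : 0 < n%:R :> R by rewrite ltr0n.
have nge1 : 1 <= n%:R :> R by rewrite ler1n.
pose m : R := n%:R^-1.
have m0 : 0 < m by rewrite invr_gt0.
have m0' : 0 <= m := ltW m0.
have mn : m * n%:R = 1 by rewrite mulVf// gt_eqF.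
have mle (a b : R) : (m * a <= b) = (a <= b * n%:R).
  by rewrite -(ler_pM2r nR) mulrAC mn mul1r.
have nm : n%:R * m = 1 by rewrite mulrC.
exists (m *: G), t; split.
- by move=> s Us; rewrite ctsfunZ GU// scaler0.
- by rewrite normrZ ger0_norm// mle.
- have pG2 : p G <= d + 2 * c.
    have -> : G = (G + h - ctsfun_cst cK y) + (ctsfun_cst cK y - h).
      by lmodule R.
    apply: le_trans (pD _ _) _; apply: lerD => //.
    apply: le_trans (pc _) _; rewrite mulrC ler_wpM2r//.
    apply: le_trans (ler_normB _ _) _.
    have : `|ctsfun_cst cK y| <= 1.
      by apply: ctsfun_le => // s; rewrite ctsfun_cstE y1.
    by lra.
  rewrite pZ ger0_norm// /m mulrC ltr_pdivrMr//.
  apply: le_lt_trans pG2 _.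
  by rewrite [e * _]mulrC -ltr_pdivrMr.
- exact: VU.
have GE : `|y + (m *: G) t - m *: w| <= d.
  have -> : y + (m *: G) t - m *: w = m *: (G t + n%:R *: y - w).
    have yE : y = m *: (n%:R *: y) by rewrite scalerA mn scale1r.
    by rewrite ctsfunZ {1}yE; lmodule R.
  rewrite normrZ ger0_norm// mle.
  by apply: le_trans (GV _ Vt) _; rewrite ler_peMr// ltW.
have mw : `|m *: w| <= 1 by rewrite normrZ ger0_norm// mle mul1r.
have xmw : 2 - d <= `|x + m *: w|.
  (* Writing n (x + w) = (n x + w) + (n - 1) w with |w| <= n turns the bound on |x + w| into |n x +
     w| >= n (2 - d). *)
  have : n%:R * (n%:R + 1 - d) <= `|n%:R *: x + w| + (n%:R - 1) * n%:R.
    apply: (@le_trans _ _ `|n%:R *: (x + w)|).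
      by rewrite normrZ ger0_norm// ler_pM2l.
    have -> : n%:R *: (x + w) = (n%:R *: x + w) + (n%:R - 1) *: w.
      by lmodule R.
    apply: le_trans (ler_normD _ _) _; rewrite lerD2l normrZ.
    by rewrite ger0_norm ?subr_ge0// ler_wpM2l// subr_ge0.
  have -> : x + m *: w = m *: (n%:R *: x + w).
    by rewrite scalerDr scalerA mn scale1r.
  move=> H; rewrite normrZ ger0_norm// /m mulrC ler_pdivlMr//.
  by nra.
split=> /=.
  have : `|x + m *: w| <= `|x + y + (m *: G) t| + d.
    have -> : x + m *: w = (x + y + (m *: G) t) - (y + (m *: G) t - m *: w).
      by lmodule R.
    by apply: le_trans (ler_normB _ _) _; rewrite lerD2l.
  by lra.
have : `|y + (m *: G) t| <= 1 + d.
  have -> : y + (m *: G) t = m *: w + (y + (m *: G) t - m *: w).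
    by lmodule R.
  by apply: le_trans (ler_normD _ _) _; rewrite lerD.
by lra.
Qed.

End localize.

(** * Values at a point of nonfriendly spaces *)

Section nested.
Context {K : topologicalType} (cK : compact [set: K]).
Context (hK : hausdorff_space K).

(** A Baire argument: the requirements are met one after the other on shrinking open sets, and
    compactness gives a point common to all of them. *)
Lemma nested_open_point (U : set K) (P : nat -> set K -> Prop) :
  open U -> U !=set0 ->
  (forall k V, open V -> V !=set0 -> V `<=` U ->
    exists V', [/\ open V', V' !=set0, V' `<=` V & P k V']) ->
  exists2 t, U t & forall k, exists2 V, V t & P k V.
Proof.
move=> oU U0 Pstep.
(* The closure of the next set is kept inside the set [V'] satisfying the requirement, so that a
   cluster point still lies in [V']. *)
have /choice[F FP] : forall kV : nat * set K, exists W, open kV.2 ->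
    kV.2 !=set0 -> kV.2 `<=` U -> [/\ open W, W !=set0 & exists V',
      [/\ closure W `<=` V', V' `<=` kV.2 & P kV.1 V']].
  move=> -[k V] /=.
  have [[oV V0 VU]|nV] := pselect [/\ open V, V !=set0 & V `<=` U]; last first.
    by exists V => oV V0 VU; exfalso; apply: nV.
  have [V' [oV' [t V't] V'V PV']] := Pstep k V oV V0 VU.
  have [A /= nA clA] : filter_from (nbhs t) closure V'.
    have nV' : nbhs t V' by exact: open_nbhs_nbhs.
    exact: (@compact_regular K t setT hK cK filterT).
  exists A° => _ _ _; split; first exact: open_interior.
    by exists t.
  exists V'; split => //; apply: subset_trans clA.
  by apply: closureS; exact: interior_subset.
pose W := fix W n := if n is m.+1 then F (m, W m) else U.
have WP n : [/\ open (W n), W n !=set0 & W n `<=` U].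
  elim: n => [|n [oW W0 WU]]; first by split.
  have [] := FP (n, W n) oW W0 WU.
  move=> oF F0 [V' [cV V'W _]]; split => //; apply: subset_trans WU.
  by apply: subset_trans V'W; apply: subset_trans cV; exact: subset_closure.
have WS n : exists V', [/\ closure (W n.+1) `<=` V', V' `<=` W n & P n V'].
  by have [oW W0 WU] := WP n; have [_ _] := FP (n, W n) oW W0 WU.
have Wdecr m n : (m <= n)%N -> W n `<=` W m.
  elim: n => [|n IH]; first by rewrite leqn0 => /eqP->.
  rewrite leq_eqVlt => /orP[/eqP->//|/IH]; apply: subset_trans.
  by have [V' [cV V'W _]] := WS n; apply: subset_trans V'W;
    apply: subset_trans cV; exact: subset_closure.
have PF : ProperFilter (filter_from setT W).
  apply: filter_from_proper; last by move=> n _; have [] := WP n.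
  apply: filter_from_filter; first by exists 0%N.
  move=> i j _ _; exists (maxn i j) => // t Wt; split.
    by apply: Wdecr Wt; rewrite leq_maxl.
  by apply: Wdecr Wt; rewrite leq_maxr.
have [t [_ tW]] := cK PF filterT.
have clt n : closure (W n) t by move=> N nN; apply: tW => //; exists n.
exists t.
  by have [V' [cV V'W _]] := WS 0%N; apply/V'W/cV/clt.
by move=> k; have [V' [cV _ PV]] := WS k; exists V' => //; apply/cV/clt.
Qed.

End nested.

Section value_set.
Context {R : realType}.

(** The dense set may miss the sphere. For each dense point and radius 1 / (m + 1), a unit vector
    that close to the point is chosen if there is one, and [x0] otherwise; a unit vector in the same
    ball is then within twice the radius of the chosen one. *)
Lemma separable_sphere (E : normedModType R) (x0 : E) :
  separable E -> `|x0| = 1 ->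
  exists q : nat -> E, (forall n, `|q n| = 1) /\
    forall x (e : R), `|x| = 1 -> 0 < e -> exists n, `|x - q n| < e.
Proof.
move=> [S /countable_injP[f finj] dS] x01.
pose near_ i m x := `|x| = 1 /\
  exists s, [/\ S s, f s = i & `|x - s| < (m.+1%:R^-1 : R)].
have /choice[q qP] : forall im : nat * nat, exists y : E, `|y| = 1 /\
    ((exists x, near_ im.1 im.2 x) -> near_ im.1 im.2 y).
  move=> -[i m] /=.
  have [[x xP]|nx] := pselect (exists x, near_ i m x); last by exists x0.
  by exists x; split => //; case: xP.
exists (fun n => q (odflt (0, 0)%N (unpickle n))); split.
  by move=> n; have [] := qP (odflt (0, 0)%N (unpickle n)).
move=> x e x1 e0; have [m em m0] := exists_nat_gt (2 / e).
have m1 : 0 < m.+1%:R^-1 :> R by rewrite invr_gt0.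
have [s [sx Ss]] : (ball x m.+1%:R^-1) `&` S !=set0.
  apply: dS; last exact: ball_open.
  by exists x; exact: ballxx.
have xs : `|x - s| < (m.+1%:R^-1 : R) by move: sx; rewrite -ball_normE.
exists (pickle (f s, m)); rewrite pickleK/=.
have [q1 [|_ [s' [Ss' fs' qs']]]] := qP (f s, m).
  by exists x; split => //; exists s.
have ss' : s' = s by apply: finj; rewrite ?inE.
move: qs'; rewrite /= {}ss' => qs.
have -> : x - q (f s, m) = (x - s) - (q (f s, m) - s) by lmodule R.
apply: le_lt_trans (ler_normB _ _) _.
have : 2 * (m.+1%:R^-1 : R) < e.
  rewrite ltr_pdivrMr// -ltr_pdivrMl// mulrC (lt_trans em)// ltr_nat//.
by apply: lt_trans; rewrite mulr_natl mulr2n ltrD.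
Qed.

(** The factor 4 counts the original tolerance and the three perturbations. *)
Lemma D_set_near (E : normedModType R) (x y x' y' z z' : E) (d : R) :
  `|x - x'| < d -> `|y - y'| < d -> `|z - z'| < d ->
  D_set x' y' d z' -> D_set x y (4 * d) z.
Proof.
move=> xx yy zz [/= D1 D2]; split => /=.
  have : `|x' + y' + z'| <= `|x + y + z| + (`|x - x'| + `|y - y'| + `|z - z'|).
    have -> : x' + y' + z' = (x + y + z) - ((x - x') + (y - y') + (z - z')).
      by lmodule R.
    apply: le_trans (ler_normB _ _) _; rewrite lerD2l.
    by apply: le_trans (ler_normD _ _) _; rewrite lerD2r ler_normD.
  by lra.
have : `|y + z| <= `|y' + z'| + (`|y - y'| + `|z - z'|).
  have -> : y + z = (y' + z') + ((y - y') + (z - z')) by lmodule R.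
  by apply: le_trans (ler_normD _ _) _; rewrite lerD2l ler_normD.
have := normr_ge0 (y - y'); have := normr_ge0 (z - z').
by lra.
Qed.

Lemma D_set_weaken (E : normedModType R) (x y z : E) (d e : R) :
  d <= e -> D_set x y d z -> D_set x y e z.
Proof. by move=> de [/= ? ?]; split => /=; lra. Qed.

Lemma closure_normP (E : normedModType R) (B : set E) (z : E) :
  closure B z <-> forall e : R, 0 < e -> exists2 b, B b & `|z - b| < e.
Proof.
split=> [clB e e0|zB N /nbhs_ballP[e /= e0 zeN]].
  have [b [Bb]] := clB _ (nbhsx_ballx z e e0).
  by rewrite -ball_normE => zb; exists b.
have [b Bb zb] := zB _ e0; exists b; split => //.
by apply: zeN; rewrite -ball_normE.
Qed.

Lemma closure_absolutely_convex (E : normedModType R) (B : set E) :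
  B !=set0 ->
  (forall (a : R) x y, 0 <= a <= 1 -> B x -> B y ->
    B (a *: x + (1 - a) *: y)) ->
  (forall (a : R) x, `|a| <= 1 -> B x -> B (a *: x)) ->
  absolutely_convex (closure B).
Proof.
move=> [b Bb] cB bB; split.
- by exists b; exact: subset_closure.
- suff conv2 (x y : E) (a : R) : 0 <= a <= 1 -> closure B x -> closure B y ->
      closure B (a *: x + (1 - a) *: y).
    by move=> x y l; rewrite !inE; apply: conv2; rewrite ge0 le1.
  move=> a01 /closure_normP Bx /closure_normP By.
  apply/closure_normP => e e0.
  have [bx Bbx xb] := Bx _ e0; have [b' Bby yb] := By _ e0.
  exists (a *: bx + (1 - a) *: b'); first exact: cB.
  have -> : a *: x + (1 - a) *: y - (a *: bx + (1 - a) *: b') =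
      a *: (x - bx) + (1 - a) *: (y - b') by lmodule R.
  apply: le_lt_trans (ler_normD _ _) _; rewrite !normrZ.
  move: a01 => /andP[a0 a1]; rewrite !ger0_norm ?subr_ge0//.
  have [->|an0] := eqVneq a 0; first by rewrite mul0r add0r subr0 mul1r.
  have : 0 < a by rewrite lt_def an0.
  by nra.
- move=> a x a1 /closure_normP Bx; apply/closure_normP => e e0.
  have [b' Bb' xb] := Bx _ e0; exists (a *: b'); first exact: bB.
  rewrite -scalerBr normrZ; apply: le_lt_trans xb.
  by rewrite ler_piMl.
Qed.

Context {K : topologicalType} (cK : compact [set: K]).
Context (hK : hausdorff_space K) {E : completeNormedModType R}.
Local Notation X := (ctsfun cK E).
Context (sepE : separable E) (usdE : usd_nonfriendly E).

(** The function need not be a multiple of [v], but its bound [M] does not depend on [U] and [e];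
    this uniformity lets averages later replace such functions by bumps. *)
Definition weakly_C_narrow (p : X -> R) := forall v : E, exists M : R,
  forall (U : set K) (e : R), open U -> U !=set0 -> 0 < e ->
  exists (f : X) (t : K), [/\ forall s, ~ U s -> f s = 0, `|f| <= M, p f < e,
    U t & `|f t - v| < e].

(** Nonfriendliness puts all vectors of norm [alpha], in particular a rescaled [v], in the closure
    of the values at one point [t] of functions bounded by 2. Scaling back by M = |v| / alpha gives
    the bound 2 M. *)
Lemma daugavet_weakly_C_narrow (p : X -> R) :
  continuous_seminorm p -> strong_daugavet p -> weakly_C_narrow p.
Proof.
move=> sp dp v; have [pD pZ [c c0 pc]] := sp.
have [v0|v0] := eqVneq v 0.
  exists 0 => U e oU [t Ut] e0; exists 0, t; split => //.
  - by rewrite normr0.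
  - by rewrite seminorm0.
  - by rewrite v0 ctsfun0 subr0 normr0.
have [alpha alpha0 nonfr] := usdE.
have v1 : `| `|v|^-1 *: v | = 1.
  by rewrite normrZ ger0_norm ?invr_ge0// mulVf// normr_eq0.
have [q [q1 qdense]] := separable_sphere sepE v1.
have nv0 : 0 < `|v| by rewrite normr_gt0.
pose M := `|v| / alpha.
have M0 : 0 < M by rewrite divr_gt0.
exists (M * 2) => U e oU U0 e0.
pose e1 := e / M; have e10 : 0 < e1 by rewrite divr_gt0.
pose good (f : X) := [/\ forall s, ~ U s -> f s = 0, `|f| <= 2 & p f < e1].
(* The requirements are enumerated by triples [(i, j, m)]: two members of the dense sequence of unit
   vectors and a tolerance 1 / (m + 1). *)
pose code k := odflt (0, 0, 0)%N (unpickle k).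
pose P k V := exists2 f : X, good f & forall s, V s ->
  D_set (q (code k).1.1) (q (code k).1.2) (4 * (code k).2.+1%:R^-1) (f s).
have [k V oV V0 VU|t Ut tP] := @nested_open_point K cK hK U P oU U0.
  set m := (code k).2.+1%:R^-1 : R.
  have m0 : 0 < m by rewrite invr_gt0.
  have m'0 : 0 < Num.min m e1 by rewrite lt_min m0.
  have [f [t [fV f2 pf Vt Dt]]] :=
    daugavet_localize hK sp dp oV V0 (q1 (code k).1.1) (q1 (code k).1.2) m'0.
  have {}Dt : D_set (q (code k).1.1) (q (code k).1.2) m (f t).
    by apply: D_set_weaken Dt; rewrite ge_min lexx.
  exists (V `&` [set s | `|f s - f t| < m]); split.
  - by apply: openI => //; exact: ctsfun_open.
  - by exists t; split => //=; rewrite subrr normr0.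
  - by move=> s [].
  - exists f.
      split=> //; first by move=> s Us; apply: fV => /VU.
      by rewrite (lt_le_trans pf)// ge_min lexx orbT.
    by move=> s [Vs /= st]; apply: D_set_near Dt => //; rewrite subrr normr0.
pose B := [set z | exists2 f, good f & z = f t].
have goodZ a f : `|a| <= 1 -> good f -> good (a *: f).
  move=> a1 [fU f2 pf]; split.
  - by move=> s Us; rewrite ctsfunZ fU// scaler0.
  - by rewrite normrZ (le_trans _ f2)// ler_piMl.
  - by rewrite pZ (le_lt_trans _ pf)// ler_piMl// seminorm_ge0.
have acB : absolutely_convex (closure B).
  apply: closure_absolutely_convex.
  - exists 0, 0; last by rewrite ctsfun0.
    by split; rewrite ?normr0 ?seminorm0.
  - move=> a _ _ /andP[a0 a1] [f gf ->] [g gg ->].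
    exists (a *: f + (1 - a) *: g) => //.
    move: gf gg => [fU f2 pf] [gU g2 pg]; split.
    + by move=> s Us; rewrite ctsfunD !ctsfunZ fU// gU// !scaler0 addr0.
    + apply: le_trans (ler_normD _ _) _; rewrite !normrZ !ger0_norm ?subr_ge0//.
      by nra.
    + apply: le_lt_trans (pD _ _) _; rewrite !pZ !ger0_norm ?subr_ge0//.
      have [->|an0] := eqVneq a 0; first by rewrite mul0r add0r subr0 mul1r.
      have : 0 < a by rewrite lt_def an0.
      by nra.
  - move=> a _ a1 [f gf ->]; exists (a *: f) => //; exact: goodZ.
have meets D : D_family D -> closure B `&` D !=set0.
  move=> [x [y [d [x1 y1 d0 ->]]]].
  (* [D_set_near] is used twice: once for spreading from a point to an open set, once for replacing
     [x] and [y] by members of [q]. *)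
  have [n [nd n0]] : exists n : nat, 4 * (4 * n.+1%:R^-1) < d /\ (0 < n)%N.
    have [n dn n0] := exists_nat_gt (16 / d); exists n; split => //.
    rewrite mulrA ltr_pdivrMr// -ltr_pdivrMl// mulrC -natrM.
    by rewrite (lt_trans dn)// ltr_nat.
  set m := n.+1%:R^-1 in nd.
  have m0 : 0 < m by rewrite invr_gt0.
  have [i xi] := qdense x m x1 m0; have [j yj] := qdense y m y1 m0.
  have [V Vt [f gf fD]] := tP (pickle (i, j, n)).
  exists (f t); split; first by apply: subset_closure; exists f.
  have := fD _ Vt; rewrite /code pickleK/= -/m => Dij.
  apply: (@D_set_weaken _ _ _ _ _ _ (ltW nd)).
  apply: D_set_near Dij; last by rewrite subrr normr0; lra.
    by lra.
  by lra.
have inB : closure B (M^-1 *: v).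
  apply: (nonfr _ (@closed_closure _ B) acB meets).
  exists (`|v|^-1 *: v); first by rewrite /unit_ball/= v1.
  by rewrite scalerA /M invf_div.
have [_ [f [fU f2 pf] ->] vf] := (closure_normP _ _).1 inB _ e10.
exists (M *: f), t; split => //.
- by move=> s Us; rewrite ctsfunZ fU// scaler0.
- by rewrite normrZ ger0_norm ?ler_wpM2l// ltW.
- by rewrite pZ ger0_norm ?(ltW M0)// mulrC -ltr_pdivlMr.
- rewrite ctsfunZ.
  have -> : M *: f t - v = - (M *: (M^-1 *: v - f t)).
    by rewrite scalerBr scalerA mulfV ?gt_eqF// scale1r opprB.
  by rewrite normrN normrZ ger0_norm ?(ltW M0)// mulrC -ltr_pdivlMr.
Qed.

End value_set.

(** * C-narrow seminorms *)

Section C_narrow.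
Context {R : realType} {K : topologicalType} (cK : compact [set: K]).
Context (hK : hausdorff_space K) {E : completeNormedModType R}.
Local Notation X := (ctsfun cK E).
Local Notation CK := (ctsfun cK (R^o : completeNormedModType R)).

Definition C_narrow (p : X -> R) := forall (v : E) (U : set K) (e : R),
  open U -> U !=set0 -> 0 < e ->
  exists (V : set K) (phi : CK), [/\ open V, V !=set0, bump U V phi &
    p (phi ** ctsfun_cst cK v) < e].

Lemma C_narrow_weakly (p : X -> R) : C_narrow p -> weakly_C_narrow p.
Proof.
move=> np v; exists `|v| => U e oU U0 e0.
have [V [phi [oV [t Vt] bphi pe]]] := np v U e oU U0 e0.
have V0 : V !=set0 by exists t.
exists (phi ** ctsfun_cst cK v), t; split => //.
- by move=> s Us; have [_ phi0 _] := bphi; rewrite ctsfun_smulE phi0// scale0r.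
- by rewrite (norm_bump_smul _ bphi V0).
- exact: (bump_sub bphi).
- have [_ _ phi1] := bphi.
  by rewrite ctsfun_smulE phi1// scale1r subrr normr0.
Qed.

Lemma weakly_C_narrow_le (p q : X -> R) :
  (forall f, q f <= p f) -> weakly_C_narrow p -> weakly_C_narrow q.
Proof.
move=> qp np v; have [M nM] := np v; exists M => U e oU U0 e0.
have [f [t [fU fM pf Ut fv]]] := nM U e oU U0 e0.
by exists f, t; split => //; exact: le_lt_trans pf.
Qed.

Lemma weakly_C_narrow0 : weakly_C_narrow (fun _ : X => 0).
Proof.
apply: C_narrow_weakly => v U e oU [t Ut] e0.
have [V [phi [oV Vt bphi]]] := exists_bump (R := R) cK hK oU Ut.
by exists V, phi; split => //; exists t.
Qed.

Let stair (p : X -> R) (v : E) (V : set K) (phi : CK) (L : R) (n : nat)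
    (d : R) (F : X) :=
  [/\ p F <= n%:R * d,
      forall s, `|F s - phi s *: v| <= L + n%:R * d &
      forall s, V s -> `|F s - phi s *: v| <= n%:R * d].

(** The uncontrolled errors, bounded by [L], do not accumulate: off [V] the new terms vanish, and on
    [V] the old error is already at most n d. *)
Let stairS (p : X -> R) (v : E) (V V' V1 : set K) (phi psi : CK) (n : nat)
    (L M d : R) (F f : X) :
  continuous_seminorm p -> 0 <= d -> M + `|v| <= L ->
  bump V1 V' psi -> V1 `<=` V ->
  (forall s, ~ V s -> f s = 0) -> `|f| <= M -> p f <= d ->
  (forall s, V1 s -> `|f s - v| <= d) ->
  stair p v V phi L n d F -> stair p v V' (phi + psi) L n.+1 d (F + f).
Proof.
move=> sp d0 ML bpsi V1V fV fM pf fv [pF FU FV]; have [pD _ _] := sp.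
have [psi01 psi0 psi1] := bpsi; have V'V1 := bump_sub bpsi.
have FE s : (F + f) s - (phi + psi) s *: v =
    (F s - phi s *: v) + (f s - psi s *: v).
  by rewrite !ctsfunD; lmodule R.
have nd : n.+1%:R * d = n%:R * d + d by rewrite -natr1 mulrDl mul1r.
rewrite /stair nd; split.
- by apply: le_trans (pD _ _) _; rewrite lerD.
- move=> s; rewrite FE; apply: le_trans (ler_normD _ _) _.
  have [Vs|nVs] := pselect (V s).
    have : `|f s - psi s *: v| <= L.
      apply: le_trans ML; apply: le_trans (ler_normB _ _) _.
      have /andP[s0 s1] := psi01 s.
      rewrite lerD ?(le_trans (ctsfun_ub _ _))//.
      by rewrite normrZ ger0_norm// ler_piMl.
    by have := FV _ Vs; lra.
  rewrite fV// psi0 ?scale0r ?subr0 ?normr0; last by move=> /V1V.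
  by have := FU s; lra.
- move=> s V's; rewrite FE psi1// scale1r.
  apply: le_trans (ler_normD _ _) _.
  by rewrite lerD ?FV ?fv//; [apply: V1V|]; exact: V'V1.
Qed.

Lemma weakly_C_narrow_near (p : X -> R) (v : E) (M : R) :
  (forall (U : set K) (e : R), open U -> U !=set0 -> 0 < e ->
    exists (f : X) (t : K), [/\ forall s, ~ U s -> f s = 0, `|f| <= M,
      p f < e, U t & `|f t - v| < e]) ->
  forall (U : set K) (e : R), open U -> U !=set0 -> 0 < e ->
    exists (f : X) (V : set K), [/\ [/\ open V, V !=set0 & V `<=` U],
      forall s, ~ U s -> f s = 0, `|f| <= M, p f <= e &
      forall s, V s -> `|f s - v| <= e].
Proof.
move=> np U e oU U0 e0; have [f [t [fU fM pf Ut ft]]] := np U e oU U0 e0.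
exists f, (U `&` [set s | `|f s - v| < e]); split => //; last 2 first.
- exact: ltW.
- by move=> s [_ /ltW].
split; last by move=> s [].
  by apply: openI => //; exact: ctsfun_open.
by exists t.
Qed.

(* Along a decreasing sequence of open sets, the average of functions that are
   close to [v] on the next set differs from the average of the bumps times [v]
   by at most one term at each point. The bumps can therefore be shared between
   [p] and [q]. *)
Lemma weakly_C_narrowD (p q : X -> R) :
  continuous_seminorm p -> continuous_seminorm q ->
  weakly_C_narrow p -> weakly_C_narrow q -> C_narrow (fun f => p f + q f).
Proof.
move=> sp sq np nq v U e oU U0 e0.
have [M /weakly_C_narrow_near nM] := np v.
have [N /weakly_C_narrow_near nN] := nq v.
pose L := `|M| + `|N| + `|v|.
have L0 : 0 <= L by rewrite !addr_ge0.
have ML : M + `|v| <= L.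
  by have := ler_norm M; have := normr_ge0 N; rewrite /L; lra.
have NL : N + `|v| <= L.
  by have := ler_norm N; have := normr_ge0 M; rewrite /L; lra.
have chain (d : R) : 0 < d -> forall n, exists (V : set K) (phi : CK) (F G : X),
    [/\ [/\ open V, V !=set0 & V `<=` U],
      [/\ forall s, 0 <= (phi s : R) <= n%:R,
          forall s, ~ U s -> phi s = 0 :> R &
          forall s, V s -> phi s = n%:R :> R],
      stair p v V phi L n d F & stair q v V phi L n d G].
  move=> d0; elim=> [|n [V [phi [F [G [[oV V0 VU] [phi01 phi0 phi1] sF sG]]]]]].
    exists U, 0, 0, 0; split; first by split.
    - by split=> // s; rewrite ctsfun0 lexx.
    - split; rewrite ?seminorm0 ?mul0r// => s; rewrite ?addr0 !ctsfun0 scale0r;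
      by rewrite subr0 normr0.
    - split; rewrite ?seminorm0 ?mul0r// => s; rewrite ?addr0 !ctsfun0 scale0r;
      by rewrite subr0 normr0.
  (* The function for [q] is sought inside the set where the one for [p] is close to [v], so that a
     single bump below both follows both. *)
  have [f [V1 [[oV1 V10 V1V] fV fM pf fv]]] := nM V d oV V0 d0.
  have [g [V2 [[oV2 [t V2t] V21] gV1 gN qg gv]]] := nN V1 d oV1 V10 d0.
  have [V3 [psi [oV3 V3t bpsi]]] := exists_bump (R := R) cK hK oV2 V2t.
  have [psi01 psi0 psi1] := bpsi; have V32 := bump_sub bpsi.
  have V2V := subset_trans V21 V1V.
  exists V3, (phi + psi), (F + f), (G + g); split.
  - by split => //; [exists t|move=> s /V32/V2V/VU].
  - split=> s; rewrite ctsfunD -?natr1.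
    + have /andP[? ?] := phi01 s; have /andP[? ?] := psi01 s.
      by apply/andP; split; [apply: addr_ge0|apply: lerD].
    + by move=> Us; rewrite phi0// psi0 ?addr0// => /V2V/VU.
    + by move=> V3s; rewrite phi1 ?psi1//; apply/V2V/V32.
  - apply: (stairS sp (ltW d0) ML bpsi V2V fV fM pf _ sF).
    by move=> s /V21/fv.
  - apply: (stairS sq (ltW d0) NL bpsi V2V _ gN qg gv sG).
    by move=> s Vs; apply: gV1 => /V1V.
have [pD pZ [b b0 pb]] := sp; have [qD qZ [c c0 qc]] := sq.
(* The final estimate is p(W) + q(W) <= (b + c) L + n (2 + b + c) d. The second term equals n e / 2
   by this choice of [d], and the first is less than n e / 2 by the choice of [n]. *)
pose d := e / (2 * (2 + (b + c))).
have dE : (2 + (b + c)) * d = e / 2 by rewrite /d; field; rewrite gt_eqF//; lra.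
have d0 : 0 < d by apply: divr_gt0 => //; lra.
have [n nlt n0] := exists_nat_gt (2 * ((b + c) * L) / e).
have [V [phi [F [G [[oV V0 VU] [phi01 phi0 phi1] [pF FU _] [qG GU _]]]]]] :=
  chain d d0 n.
have nR : 0 < n%:R :> R by rewrite ltr0n.
have ni0 : 0 <= n%:R^-1 :> R by rewrite invr_ge0 ltW.
have nd0 : 0 <= n%:R * d by rewrite mulr_ge0// ltW.
exists V, (n%:R^-1 *: phi); split => //.
  have phiE s : (n%:R^-1 *: phi) s = n%:R^-1 * (phi s : R) :> R by [].
  split=> s; rewrite phiE.
  - have /andP[s0 s1] := phi01 s.
    apply/andP; split; first exact: mulr_ge0.
    by rewrite mulrC ler_pdivrMr// mul1r.
  - by move=> Us; rewrite phi0// mulr0.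
  - by move=> Vs; rewrite phi1// mulVf// gt_eqF.
pose W := phi ** ctsfun_cst cK v.
have -> : (n%:R^-1 *: phi) ** ctsfun_cst cK v = n%:R^-1 *: W.
  by apply/ctsfunP => s; rewrite ctsfunZ !ctsfun_smulE ctsfunZ scalerA.
rewrite pZ qZ -mulrDr ger0_norm// mulrC ltr_pdivrMr//.
have FW : `|F - W| <= L + n%:R * d by apply: ctsfun_le => //; exact: addr_ge0.
have GW : `|G - W| <= L + n%:R * d by apply: ctsfun_le => //; exact: addr_ge0.
have pW : p W <= n%:R * d + b * (L + n%:R * d).
  have -> : W = F - (F - W) by lmodule R.
  apply: le_trans (seminormB _ _ sp) _; rewrite lerD//.
  by apply: le_trans (pb _) _; rewrite ler_wpM2l.
have qW : q W <= n%:R * d + c * (L + n%:R * d).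
  have -> : W = G - (G - W) by lmodule R.
  apply: le_trans (seminormB _ _ sq) _; rewrite lerD//.
  by apply: le_trans (qc _) _; rewrite ler_wpM2l.
move: nlt; rewrite ltr_pdivrMr// => nlt.
have : n%:R * ((2 + (b + c)) * d) = n%:R * (e / 2) by rewrite dE.
by nra.
Qed.

End C_narrow.

(** * Uniform boundedness of partial sums *)

Section block_permutation.
Variables (m : nat -> nat) (L : nat -> seq nat).
Hypothesis (m0 : m 0%N = 0%N) (mS : forall k, (m k < m k.+1)%N).
Hypothesis permL : forall k, perm_eq (L k) (index_iota (m k) (m k.+1)).

Let m_ge k : (k <= m k)%N.
Proof. by elim: k => // k IH; exact: leq_ltn_trans IH (mS k). Qed.

Let m_mono i j : (i <= j)%N -> (m i <= m j)%N.
Proof.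
elim: j => [|j IH]; first by rewrite leqn0 => /eqP->.
by rewrite leq_eqVlt => /orP[/eqP->//|/IH]/leq_trans; apply; exact: ltnW.
Qed.

Let block_ex : exists b : nat -> nat, forall i, (m (b i) <= i < m (b i).+1)%N.
Proof.
have ex i : exists k, (i < m k.+1)%N by exists i; exact: m_ge.
exists (fun i => ex_minn (ex i)) => i.
case: ex_minnP => k ik kmin; rewrite ik andbT leqNgt.
case: k ik kmin => [|k] ik kmin; first by rewrite m0.
by apply/negP => /kmin; rewrite ltnn.
Qed.

Let block_uniq i k l :
  (m k <= i < m k.+1)%N -> (m l <= i < m l.+1)%N -> k = l.
Proof.
move=> /andP[ki ik] /andP[li il].
apply/eqP; rewrite eqn_leq; apply/andP; split; rewrite leqNgt;
  apply/negP => /m_mono.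
  by rewrite leqNgt (leq_ltn_trans ki il).
by rewrite leqNgt (leq_ltn_trans li ik).
Qed.

Let mem_L k j : (j \in L k) = (m k <= j < m k.+1)%N.
Proof. by rewrite (perm_mem (permL k)) mem_index_iota. Qed.

Let size_L k : size (L k) = (m k.+1 - m k)%N.
Proof. by rewrite (perm_size (permL k)) size_iota. Qed.

Let uniq_L k : uniq (L k).
Proof. by rewrite (perm_uniq (permL k)) iota_uniq. Qed.

(** The blocks partition the naturals, so permutations of the single blocks glue together. *)
Lemma block_permutation : exists2 s : nat -> nat, bijective s &
  forall k, map s (index_iota (m k) (m k.+1)) = L k.
Proof.
have [block blockP] := block_ex.
have block_eq i k : (m k <= i < m k.+1)%N -> block i = k.
  by move=> ik; apply: block_uniq ik; exact: blockP.
(* [s] reads the list of its block at the offset of [i]; [r] recovers the offset by [index]. *)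
pose s i := nth 0%N (L (block i)) (i - m (block i)).
pose r j := (m (block j) + index j (L (block j)))%N.
have s_lt i : (i - m (block i) < size (L (block i)))%N.
  rewrite size_L; have /andP[bi ib] := blockP i.
  by rewrite ltn_sub2r// (leq_ltn_trans bi).
have s_in i : s i \in L (block i) by exact: mem_nth.
have block_s i : block (s i) = block i.
  by apply: block_eq; rewrite -mem_L.
have j_in j : j \in L (block j) by rewrite mem_L; exact: blockP.
have block_r j : block (r j) = block j.
  apply: block_eq; rewrite /r leq_addr/= -ltn_subRL -size_L index_mem.
  exact: j_in.
exists s.
  exists r => i.
    rewrite /r block_s /s index_uniq// subnKC//.
    by have /andP[] := blockP i.
  by rewrite /s block_r /r addKn nth_index.
move=> k; apply: (@eq_from_nth _ 0%N).
  by rewrite size_map size_iota size_L.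
move=> i; rewrite size_map size_iota => ik.
rewrite (nth_map 0%N) ?size_iota// nth_iota// /s.
have -> : block (m k + i)%N = k.
  by apply: block_eq; rewrite leq_addr/= -ltn_subRL.
by rewrite addKn.
Qed.

End block_permutation.

Section unconditional.
Context {R : realType} {W : normedModType R}.

Lemma series_tail (a : nat -> W) (e : R) : cvgn (series a) -> 0 < e ->
  exists N, forall m n, (N <= m)%N -> (N <= n)%N ->
    `|\sum_(m <= k < n) a k| < e.
Proof.
move=> /cvg_cauchy/cauchy_seriesP/[apply] -[[A B] /= [[N _ NA] [N' _ NB]] AB].
exists (maxn N N') => m n; rewrite !geq_max => /andP[Nm _] /andP[_ Nn].
by apply: (AB (m, n)); split; [exact: NA|exact: NB].
Qed.

(** Otherwise there are successive blocks, each with a subset whose sum has norm above 1. Moving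
    that subset to the front of its block gives a rearrangement that is not Cauchy. *)
Lemma unconditionally_cvg_bounded (a : nat -> W) : unconditionally_cvg a ->
  exists B : R, forall (P : pred nat) n, `|\sum_(0 <= i < n | P i) a i| <= B.
Proof.
move=> ca; apply: contrapT => /forallNP unb.
have /choice[F FP] : forall k : nat, exists Pn : pred nat * nat,
    (k < Pn.2)%N /\ 1 < `|\sum_(k <= i < Pn.2 | Pn.1 i) a i|.
  (* The indices below [k] contribute at most [B - 1], so a subset sum exceeding [B] leaves more
     than 1 from [k] on. *)
  move=> k; pose B := 1 + \sum_(0 <= i < k) `|a i|.
  have /existsNP[P /existsNP[n /negP]] := unb B; rewrite -ltNge => Bn.
  have masked (Q : pred nat) l : `|\sum_(0 <= i < l | Q i) a i| <=
      \sum_(0 <= i < l) `|a i|.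
    apply: le_trans (ler_norm_sum _ _ _) _; rewrite big_mkcond/=.
    by apply: ler_sum => i _; case: ifP.
  have kn : (k < n)%N.
    rewrite ltnNge; apply/negP => nk; move: Bn; apply/negP; rewrite -leNgt.
    apply: le_trans (masked P n) _; rewrite /B (big_cat_nat (leq0n _) nk)//=.
    have : 0 <= \sum_(n <= i < k) `|a i| by apply: sumr_ge0.
    by move: (\sum_(0 <= i < n) _) (\sum_(n <= i < k) _) => x y; lra.
  exists (P, n); split => //=; move: Bn.
  rewrite (big_cat_nat (leq0n _) (ltnW kn))//=.
  move=> /lt_le_trans/(_ (ler_normD _ _)); have := masked P k; rewrite /B; lra.
pose m := fix m k := if k is l.+1 then (F (m l)).2 else 0%N.
have mS k : (m k < m k.+1)%N by have [] := FP (m k).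
pose Q k := (F (m k)).1.
pose L k := [seq i <- index_iota (m k) (m k.+1) | Q k i] ++
            [seq i <- index_iota (m k) (m k.+1) | predC (Q k) i].
have permL k : perm_eq (L k) (index_iota (m k) (m k.+1)).
  by rewrite /L perm_filterC.
have [s bs sL] := block_permutation (erefl : m 0%N = 0%N) mS permL.
have [N NP] := series_tail (ca s bs) ltr01.
have m_ge k : (k <= m k)%N.
  by elim: k => // k IH; exact: leq_ltn_trans IH (mS k).
(* The first [c] places of the rearranged block hold exactly the selected indices. *)
pose c := size [seq i <- index_iota (m N) (m N.+1) | Q N i].
have cle : (m N + c <= m N.+1)%N.
  rewrite -leq_subRL ?(ltnW (mS N))// /c size_filter.
  by rewrite (leq_trans (count_size _ _))// size_iota.
have := NP _ _ (m_ge N) (leq_trans (m_ge N) (leq_addr c (m N))).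
apply/negP; rewrite -leNgt.
have -> : \sum_(m N <= k < m N + c) (a \o s) k =
    \sum_(m N <= i < m N.+1 | Q N i) a i.
  rewrite -[RHS]big_filter -(big_map s xpredT a).
  have -> : index_iota (m N) (m N + c) = take c (index_iota (m N) (m N.+1)).
    rewrite /index_iota take_iota addKn; congr iota; apply/esym/minn_idPl.
    by rewrite leq_subRL ?(ltnW (mS N)).
  by rewrite map_take sL /L take_size_cat.
by have [_ /ltW] := FP (m N).
Qed.

End unconditional.

Section uniform_bound.
Context {R : realType} {X : completeNormedModType R} {W : normedModType R}.
Context (T_ : nat -> X -> W) (bT : forall n, bounded_operator (T_ n)).
Context (cvgT : forall f, unconditionally_cvg (fun n => T_ n f)).

(** The uniform boundedness principle for all subset sums, whose pointwise bounds come from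
    unconditional convergence. Arbitrary predicates are allowed because the signs in the later block
    sums depend on the construction. *)
Lemma partial_sums_bounded : exists2 C : R, 0 < C &
  forall (P : pred nat) n f, `|\sum_(0 <= i < n | P i) T_ i f| <= C * `|f|.
Proof.
pose S (g : X -> W) := exists (P : pred nat) n,
  g = fun f => \sum_(0 <= i < n | P i) T_ i f.
have /choice[c cP] : forall n, exists c : R, 0 < c /\
    forall f, `|T_ n f| <= c * `|f|.
  by move=> n; have [c c0 cP] := operator_bound (bT n); exists c.
have linS g : S g -> linear g.
  move=> [P [n ->]] a x y; rewrite scaler_sumr -big_split/=.
  by apply: eq_bigr => i _; have [lT _] := bT i; exact: lT.
have [||M MP] := @Banach_Steinhauss R X W S _ _ 1.
- move=> g Sg; split; last exact: linS.
  case: Sg => P [n ->] r; exists (\sum_(0 <= i < n | P i) c i * r) => x xr.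
  apply: le_trans (ler_norm_sum _ _ _) _; apply: ler_sum => i _.
  have [c0 Tc] := cP i; apply: le_trans (Tc x) _.
  by rewrite ler_wpM2l// ltW.
- move=> f; have [B BP] := unconditionally_cvg_bounded (@cvgT f).
  by exists B => _ [P [n ->]]; exact: BP.
exists (`|M| + 1) => [|P n f]; first by rewrite ltr_wpDl.
have Sg : S (fun f => \sum_(0 <= i < n | P i) T_ i f) by exists P, n.
have [->|f0] := eqVneq f 0.
  by have := operator0 (linS _ Sg) => /= ->; rewrite !normr0 mulr0.
have nf : 0 < `|f| by rewrite normr_gt0.
have := MP _ Sg (`|f|^-1 *: f); rewrite (operatorZ _ _ (linS _ Sg)) !normrZ.
rewrite ger0_norm ?invr_ge0// mulVf ?gt_eqF// => /(_ (lexx _)).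
rewrite mulrC ler_pdivrMr// => /le_trans; apply.
by rewrite ler_wpM2r// (le_trans (ler_norm _))// lerDl.
Qed.

End uniform_bound.

(** * Unconditionally convergent sums *)

Section sum.
Context {R : realType} {K : topologicalType} (cK : compact [set: K]).
Context (hK : hausdorff_space K) {E W : completeNormedModType R}.
Local Notation X := (ctsfun cK E).
Local Notation CK := (ctsfun cK (R^o : completeNormedModType R)).
Context (T_ : nat -> X -> W) (bT : forall n, bounded_operator (T_ n)).
Context (cvgT : forall f, unconditionally_cvg (fun n => T_ n f)).

Let cvg_sum f : cvgn (series (fun n => T_ n f)).
Proof.
by have := @cvgT f id; apply; exists id.
Qed.

Let T (f : X) : W := limn (series (fun n => T_ n f)).

Let partialE f n : series (fun i => T_ i f) n = \sum_(0 <= i < n) T_ i f.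
Proof. by []. Qed.

Lemma sum_near (f : X) (N : nat) (d : R) :
  (forall m, (N <= m)%N -> `|\sum_(N <= i < m) T_ i f| <= d) ->
  `|T f - \sum_(0 <= i < N) T_ i f| <= d.
Proof.
move=> tail; apply/ler_addgt0Pr => e e0.
have /cvgrPdist_lt/(_ _ e0)[m _ mP] := @cvg_sum f.
have Nm : (N <= maxn N m)%N by rewrite leq_maxl.
have := mP (maxn N m); rewrite /= leq_maxr => /(_ isT).
rewrite partialE (big_cat_nat (leq0n _) Nm)/=.
set S := \sum_(0 <= i < N) _; set S' := \sum_(N <= i < _) _ => TS.
have -> : T f - S = S' + (T f - (S + S')) by lmodule R.
by apply: le_trans (ler_normD _ _) _; rewrite lerD ?tail// ltW.
Qed.

Lemma sum_operator : bounded_operator T.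
Proof.
have lT : linear T.
  move=> a f g; apply: cvg_lim => //.
  have -> : series (fun n => T_ n (a *: f + g)) =
      (fun n => a *: series (fun i => T_ i f) n + series (fun i => T_ i g) n).
    apply/funext => n; rewrite !partialE scaler_sumr -big_split/=.
    by apply: eq_bigr => i _; have [li _] := bT i; exact: li.
  by apply: cvgD; [apply: cvgZl_tmp|]; exact: cvg_sum.
split => //.
pose T' : {linear X -> W} := HB.pack T (GRing.isLinear.Build _ _ _ _ _ lT).
have [C C0 CP] := partial_sums_bounded bT cvgT.
suff : bounded_near T' (nbhs 0) by [].
apply/linear_boundedP; near=> r => f.
apply: (@le_trans _ _ (C * `|f|)); last by rewrite ler_wpM2r.
apply/ler_addgt0Pr => e e0.
have [N NP] := series_tail (@cvg_sum f) e0.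
have -> : T' f = (T f - \sum_(0 <= i < N) T_ i f) + \sum_(0 <= i < N) T_ i f.
  by rewrite subrK.
apply: le_trans (ler_normD _ _) _; rewrite [leRHS]addrC.
have CPN : `|\sum_(0 <= i < N) T_ i f| <= C * `|f| by exact: (CP xpredT N f).
apply: lerD _ CPN.
by apply: sum_near => m Nm; apply/ltW/NP.
Unshelve. all: by end_near. Qed.

Context (q : X -> R) (sq : continuous_seminorm q) (nq : weakly_C_narrow q).
Context (nT : forall n, weakly_C_narrow (fun f => `|T_ n f|)).

Lemma partial_C_narrow N :
  C_narrow (fun f => q f + \sum_(0 <= i < N) `|T_ i f|).
Proof.
have [sN nN] :
    continuous_seminorm (fun f => q f + \sum_(0 <= i < N) `|T_ i f|) /\
    weakly_C_narrow (fun f => q f + \sum_(0 <= i < N) `|T_ i f|).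
  elim: N => [|N [sN nN]].
    by under eq_fun do rewrite big_nil addr0.
  under eq_fun do rewrite big_nat_recr//= addrA.
  have sT := operator_seminorm (bT N).
  split; first exact: continuous_seminormD.
  exact/C_narrow_weakly/weakly_C_narrowD.
move=> v U e oU U0 e0.
(* Adding the zero seminorm upgrades weak C-narrowness to C-narrowness. *)
have [V [phi [oV V0 bphi pe]]] := weakly_C_narrowD hK sN continuous_seminorm0
  nN (weakly_C_narrow0 cK hK) v oU U0 e0.
by exists V, phi; rewrite addr0 in pe.
Qed.

(** Here [phi] is the sum of the bumps, [a] their alternating sum, [N] the current cut and [s] the
    signs of the blocks. Each new bump is small for the operators before [N], and each new cut makes
    the tails at [phiv] and [av] small. *)
Lemma sum_chain (v : E) (U : set K) (d : R) : open U -> U !=set0 -> 0 < d ->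
  forall n, exists (V : set K) (phi a : CK) (N : nat) (s : pred nat),
    let phiv := phi ** ctsfun_cst cK v in
    let av := a ** ctsfun_cst cK v in
    [/\ [/\ open V, V !=set0 & V `<=` U],
      [/\ forall t, 0 <= (phi t : R) <= n%:R,
          forall t, ~ U t -> phi t = 0 :> R &
          forall t, V t -> phi t = n%:R :> R],
      (forall t, 0 <= (a t : R) <= 1) /\
        (exists b : bool, forall t, V t -> a t = b%:R :> R),
      [/\ `|\sum_(0 <= i < N) T_ i phiv
            - \sum_(0 <= i < N) (-1) ^+ s i *: T_ i av| <= 4 * n%:R * d,
          forall m, (N <= m)%N -> `|\sum_(N <= i < m) T_ i phiv| <= d &
          forall m, (N <= m)%N -> `|\sum_(N <= i < m) T_ i av| <= d] &
      q phiv <= n%:R * d].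
Proof.
move=> oU U0 d0; elim=> [|n [V [phi [a [N [s IH]]]]]].
  have phi0 : (0 : CK) ** ctsfun_cst cK v = 0.
    by apply/ctsfunP => t; rewrite ctsfun_smulE ctsfun0 scale0r.
  have T0 i : T_ i 0 = 0 by have [li _] := bT i; rewrite operator0.
  exists U, 0, 0, 0%N, xpred0; rewrite /= phi0; split.
  - by split.
  - by split=> // t; apply/andP; split; exact: lexx.
  - split; last by exists false.
    by move=> t; apply/andP; split; [exact: lexx|exact: ler01].
  - split; first by rewrite !big_nil subr0 normr0 mulr0 mul0r.
      by move=> m _; rewrite big1 ?normr0 ?ltW.
    by move=> m _; rewrite big1 ?normr0 ?ltW.
  - by rewrite seminorm0// mul0r.
case: IH => [[oV V0 VU] [phi01 phi0 phi1] [a01 [b aV]] [err tphi ta] qphi].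
have [V' [psi [oV' V'0 bpsi]]] := partial_C_narrow N v oV V0 d0.
set psiv := psi ** _; set phiv := phi ** _ in err tphi qphi *.
set av := a ** _ in err ta * => psid.
have [psi01 psi0 psi1] := bpsi; have V'V := bump_sub bpsi.
(* On [V], which contains the support of [psi], [a] is constantly 0 or 1; this sign moves it towards
   the other value, so [a] stays between 0 and 1. *)
pose e : R := (-1) ^+ b.
have phiv' : (phi + psi) ** ctsfun_cst cK v = phiv + psiv.
  by apply/ctsfunP => t; rewrite ctsfunD !ctsfun_smulE ctsfunD scalerDl.
have av' : (a + e *: psi) ** ctsfun_cst cK v = av + e *: psiv.
  apply/ctsfunP => t; rewrite ctsfunD ctsfunZ !ctsfun_smulE ctsfunD ctsfunZ.
  by rewrite scalerDl -scalerA.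
have [N1 N1P] := series_tail (@cvg_sum (phiv + psiv)) d0.
have [N2 N2P] := series_tail (@cvg_sum (av + e *: psiv)) d0.
pose N' := maxn N (maxn N1 N2).
have NN' : (N <= N')%N by rewrite leq_maxl.
have N1N' : (N1 <= N')%N by rewrite !leq_max leqnn orbT.
have N2N' : (N2 <= N')%N by rewrite !leq_max leqnn !orbT.
exists V', (phi + psi), (a + e *: psi), N',
  (fun i => if (i < N)%N then s i else b).
rewrite /= phiv' av'; split.
- by split => //; exact: subset_trans V'V VU.
- split=> t; rewrite ctsfunD -?natr1.
  + have /andP[? ?] := phi01 t; have /andP[? ?] := psi01 t.
    by apply/andP; split; [apply: addr_ge0|apply: lerD].
  + by move=> Ut; rewrite phi0// psi0 ?addr0// => /VU.
  + by move=> V't; rewrite phi1 ?psi1//; exact: V'V.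
- have aE t : (a + e *: psi) t = (a t : R) + e * (psi t : R) :> R by [].
  split=> [t|].
    rewrite aE; have [Vt|nVt] := pselect (V t); last first.
      by rewrite psi0// mulr0 addr0.
    rewrite aV// /e; have := psi01 t.
    by case: (b); rewrite /= ?expr1 ?expr0; lra.
  exists (~~ b) => t V't; rewrite aE aV ?psi1 ?mulr1//; last exact: V'V.
  by rewrite /e; case: (b); rewrite /= ?expr1 ?expr0; lra.
- split; last 2 first.
  + by move=> m N'm; apply/ltW/N1P => //; exact: leq_trans N'm.
  + by move=> m N'm; apply/ltW/N2P => //; exact: leq_trans N'm.
  have TD i f g : T_ i (f + g) = T_ i f + T_ i g.
    by have [li _] := bT i; rewrite operatorD.
  have TZ i c f : T_ i (c *: f) = c *: T_ i f.
    by have [li _] := bT i; rewrite operatorZ.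
  rewrite !(big_cat_nat (leq0n N) NN')/=.
  under eq_bigr do rewrite TD; rewrite big_split/=.
  under [X in _ + X - _]eq_bigr do rewrite TD; rewrite big_split/=.
  rewrite [X in _ - (X + _)](_ : _ =
      \sum_(0 <= i < N) (-1) ^+ s i *: T_ i av
      + e *: \sum_(0 <= i < N) (-1) ^+ s i *: T_ i psiv); last first.
    rewrite scaler_sumr -big_split/=; apply: eq_big_nat => i /andP[_ ->].
    by rewrite TD TZ scalerDr !scalerA mulrC.
  rewrite [X in _ - (_ + X)](_ : _ =
      e *: \sum_(N <= i < N') T_ i av
      + \sum_(N <= i < N') T_ i psiv); last first.
    rewrite scaler_sumr -big_split/=; apply: eq_big_nat => i /andP[Ni _].
    rewrite ltnNge Ni/= TD TZ scalerDr scalerA -/e.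
    by rewrite -expr2 sqrr_sign scale1r.
  move: err (tphi _ NN') (ta _ NN') psid.
  set A := \sum_(0 <= i < N) T_ i phiv; set A2 := \sum_(N <= i < N') T_ i phiv.
  set B := \sum_(0 <= i < N) T_ i psiv; set B2 := \sum_(N <= i < N') T_ i psiv.
  set C := \sum_(0 <= i < N) _ *: T_ i av; set C2 := \sum_(N <= i < N') T_ i av.
  set D := \sum_(0 <= i < N) _ *: T_ i psiv => AC A2d C2d psid.
  have psid' : \sum_(0 <= i < N) `|T_ i psiv| <= d.
    by apply: ltW; apply: le_lt_trans psid; rewrite lerDr seminorm_ge0.
  have Bd : `|B| <= d by apply: le_trans psid'; exact: ler_norm_sum.
  have Dd : `|D| <= d.
    apply: le_trans psid'; apply: le_trans (ler_norm_sum _ _ _) _.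
    by apply: ler_sum => i _; rewrite normrZ normr_sign mul1r.
  (* On the new block the sign of [psiv] in the alternating sum cancels against the block sign, so
     [B2] drops out. Each of the four remaining new terms has norm at most [d], whence the 4 in the
     statement. *)
  have -> : A + B + (A2 + B2) - (C + e *: D + (e *: C2 + B2)) =
      (A - C) + (A2 + B - e *: (C2 + D)) by lmodule R.
  apply: le_trans (ler_normD _ _) _.
  have : `|A2 + B - e *: (C2 + D)| <= (d + d) + (d + d).
    apply: le_trans (ler_normB _ _) _; rewrite normrZ normr_sign mul1r.
    by apply: lerD; apply: le_trans (ler_normD _ _) _; exact: lerD.
  by rewrite -[n.+1%:R]natr1; lra.
- have [qD _ _] := sq; apply: le_trans (qD _ _) _.
  rewrite -natr1 mulrDl mul1r lerD//; apply: ltW; apply: le_lt_trans psid.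
  by rewrite lerDl sumr_ge0.
Qed.

Lemma sum_C_narrow : C_narrow (fun f => `|T f| + q f).
Proof.
move=> v U e oU U0 e0.
have [C C0 CP] := partial_sums_bounded bT cvgT.
have [_ TZ _] := operator_seminorm sum_operator; have [_ qZ _] := sq.
(* The errors proportional to n are 4 n d for the sum and n d for [q], together n e / 2; the choice
   of [n] puts the remainder 2 C |v| + d below n e / 2. *)
pose d := e / 10; have d0 : 0 < d by rewrite divr_gt0.
have [n nlt n0] := exists_nat_gt ((2 * C * `|v| + d) / (e / 2)).
have [V [phi [a [N [s /= [[oV V0 VU] [phi01 phi0 phi1] [a01 _]
  [err tphi _] qphi]]]]]] := sum_chain v oU U0 d0 n.
set phiv := phi ** _ in err tphi qphi; set av := a ** _ in err.
have nR : 0 < n%:R :> R by rewrite ltr0n.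
have ni0 : 0 <= n%:R^-1 :> R by rewrite invr_ge0 ltW.
exists V, (n%:R^-1 *: phi); split => //.
  have phiE t : (n%:R^-1 *: phi) t = n%:R^-1 * (phi t : R) :> R by [].
  split=> t; rewrite phiE.
  - have /andP[t0 t1] := phi01 t.
    apply/andP; split; first exact: mulr_ge0.
    by rewrite mulrC ler_pdivrMr// mul1r.
  - by move=> Ut; rewrite phi0// mulr0.
  - by move=> Vt; rewrite phi1// mulVf// gt_eqF.
have -> : (n%:R^-1 *: phi) ** ctsfun_cst cK v = n%:R^-1 *: phiv.
  by apply/ctsfunP => t; rewrite ctsfunZ !ctsfun_smulE ctsfunZ scalerA.
rewrite TZ qZ -mulrDr ger0_norm// mulrC ltr_pdivrMr//.
have av1 : `|av| <= `|v|.
  apply: ctsfun_le => // t; have /andP[t0 t1] := a01 t.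
  by rewrite ctsfun_smulE normrZ ger0_norm// ler_piMl.
have signed : `|\sum_(0 <= i < N) (-1) ^+ s i *: T_ i av| <= 2 * C * `|v|.
  (* A signed sum is a difference of two subset sums, hence the factor 2. *)
  have -> : \sum_(0 <= i < N) (-1) ^+ s i *: T_ i av =
      \sum_(0 <= i < N | ~~ s i) T_ i av - \sum_(0 <= i < N | s i) T_ i av.
    rewrite (bigID s)/= addrC -sumrN; congr (_ + _); apply: eq_bigr => i.
      by move=> /negbTE->; rewrite expr0 scale1r.
    by move=> ->; rewrite expr1 scaleN1r.
  apply: le_trans (ler_normB _ _) _.
  have Cav : C * `|av| <= C * `|v| by rewrite ler_pM2l.
  have := CP (fun i => ~~ s i) N av; have := CP s N av.
  by lra.
have := sum_near tphi; move: err signed.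
set S := \sum_(0 <= i < N) T_ i phiv; set S' := \sum_(0 <= i < N) _ *: _.
move=> err signed near_.
have : `|T phiv| <= d + (4 * n%:R * d + 2 * C * `|v|).
  have -> : T phiv = (T phiv - S) + ((S - S') + S') by lmodule R.
  apply: le_trans (ler_normD _ _) _; apply: lerD => //.
  by apply: le_trans (ler_normD _ _) _; exact: lerD.
move: nlt; rewrite ltr_pdivrMr; last by rewrite divr_gt0.
by move: qphi; rewrite /d; lra.
Qed.

End sum.

(** * From C-narrowness back to the strong Daugavet condition *)

Section daugavet_of_C_narrow.
Context {R : realType} {K : topologicalType} (cK : compact [set: K]).
Context {E : completeNormedModType R}.
Local Notation X := (ctsfun cK E).
Local Notation CK := (ctsfun cK (R^o : completeNormedModType R)).

(** Near a point [t0] where |x| is almost 1, a bump moves [y] to the direction [z] of [x t0]. There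
    the sum with [x] has norm almost 2, and C-narrowness for the vector [y t0 - z] makes the change
    small for [p]. *)
Lemma C_narrow_strong_daugavet (p : X -> R) :
  continuous_seminorm p -> C_narrow p -> strong_daugavet p.
Proof.
move=> sp np x y e x1 y1 e0; have [pD _ [c c0 pc]] := sp.
pose d := e / (4 * (e + c + 1)).
have dE : (e + c + 1) * d = e / 4 by rewrite /d; field; rewrite gt_eqF//; lra.
have d0 : 0 < d by apply: divr_gt0 => //; lra.
have d1 : d < 1 by nra.
have de : d < e / 2 by nra.
have cd : c * d < e / 2 by nra.
rewrite /unit_sphere/= in x1 y1.
have xd : 1 - d < `|x| by rewrite x1; lra.
have [|t0 xt0] := ctsfun_gtP _ xd; first by rewrite subr_ge0 ltW.
pose U := [set t | `|x t - x t0| < d] `&` [set t | `|y t - y t0| < d].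
have oU : open U by apply: openI; exact: ctsfun_open.
have Ut0 : U t0 by split; rewrite /= subrr normr0.
have xn0 : 0 < `|x t0| by apply: le_lt_trans xt0; lra.
pose z := `|x t0|^-1 *: x t0.
have z1 : `|z| = 1 by rewrite normrZ ger0_norm ?invr_ge0// mulVf// gt_eqF.
have e20 : 0 < e / 2 by rewrite divr_gt0.
have [V [phi [oV [t Vt] bphi pphi]]] :=
  np (y t0 - z) U (e / 2) oU (ex_intro _ t0 Ut0) e20.
have [phi01 phi0 phi1] := bphi.
pose D := phi ** (y - ctsfun_cst cK z).
have y_le s : `|y s| <= 1 by rewrite -y1; exact: ctsfun_ub.
exists (y - D); split.
- apply: ctsfun_le => // s; have /andP[s0 s1] := phi01 s.
  have -> : (y - D) s = (1 - phi s) *: y s + phi s *: z.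
    by rewrite ctsfunB ctsfun_smulE ctsfunB ctsfun_cstE; lmodule R.
  apply: le_trans (ler_normD _ _) _; rewrite normrZ [`|phi s *: z|]normrZ z1.
  rewrite !ger0_norm ?subr_ge0//.
  by have := y_le s; nra.
- apply: lt_le_trans (ctsfun_ub _ t).
  have -> : (x + (y - D)) t = x t0 + z + (x t - x t0).
    rewrite ctsfunD ctsfunB ctsfun_smulE phi1// ctsfunB ctsfun_cstE scale1r.
    by lmodule R.
  have [xt _] := bump_sub bphi Vt; rewrite /= in xt.
  have xz : `|x t0 + z| = `|x t0| + 1.
    have -> : x t0 + z = (`|x t0| + 1) *: z.
      by rewrite scalerDl scale1r /z scalerA mulfV ?gt_eqF// scale1r.
    by rewrite normrZ z1 mulr1 ger0_norm// addr_ge0.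
  have : `|x t0 + z| <= `|x t0 + z + (x t - x t0)| + `|x t - x t0|.
    have {1}-> : x t0 + z = (x t0 + z + (x t - x t0)) - (x t - x t0).
      by lmodule R.
    exact: ler_normB.
  by lra.
(* The first term is controlled by C-narrowness, the second by the continuity of [p], since [y]
   varies by less than [d] on the set outside which [phi] vanishes. *)
- have -> : y - (y - D) = phi ** ctsfun_cst cK (y t0 - z) +
      phi ** (y - ctsfun_cst cK (y t0)).
    apply/ctsfunP => s; rewrite ctsfunB ctsfunD !ctsfun_smulE.
    by rewrite !ctsfunB ctsfun_smulE ctsfunB !ctsfun_cstE; lmodule R.
  apply: le_lt_trans (pD _ _) _.
  have : p (phi ** (y - ctsfun_cst cK (y t0))) <= c * d.
    apply: le_trans (pc _) _; rewrite ler_wpM2l//.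
    apply: ctsfun_le => [|s]; first exact: ltW.
    rewrite ctsfun_smulE ctsfunB ctsfun_cstE normrZ.
    have [Us|nUs] := pselect (U s); last first.
      by rewrite phi0// normr0 mul0r ltW.
    have [_ /= ys] := Us; have /andP[s0 s1] := phi01 s.
    by rewrite ger0_norm// (le_trans _ (ltW ys))// ler_piMl.
  by lra.
Qed.

End daugavet_of_C_narrow.

Theorem corollary4p5 (R : realType) (K : topologicalType)
    (K0 : [set: K] !=set0) (cK : compact [set: K]) (hK : hausdorff_space K)
    (E : completeNormedModType R) (sepE : separable E)
    (usdE : usd_nonfriendly E) (W : completeNormedModType R)
    (T_ : nat -> ctsfun cK E -> W) (narrowT : forall n, narrow (T_ n))
    (cvgT : forall f, unconditionally_cvg (fun n => T_ n f)) :
  narrow (fun f => limn (series (fun n => T_ n f))).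
Proof.
have bT n : bounded_operator (T_ n) by have [] := narrowT n.
split; first exact: sum_operator.
move=> x y xs e x1 y1 bxs e0.
have sxs := operator_seminorm bxs.
(* Narrowness of [T_ n] is the strong Daugavet condition for this sum, which dominates both of its
   terms; weak C-narrowness therefore passes to each of them, [xs] included. *)
have weak n : weakly_C_narrow (fun f => `|T_ n f| + `|xs f|).
  apply: daugavet_weakly_C_narrow => //.
    exact: continuous_seminormD (operator_seminorm (bT n)) sxs.
  by move=> x' y' e' x'1 y'1 e'0; have [_ nT] := narrowT n; exact: nT.
have nT n : weakly_C_narrow (fun f => `|T_ n f|).
  by apply: weakly_C_narrow_le (weak n) => f; rewrite lerDl.
have nxs : weakly_C_narrow (fun f => `|xs f|).
  by apply: weakly_C_narrow_le (weak 0%N) => f; rewrite lerDr.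
have nsum := sum_C_narrow hK bT cvgT sxs nxs nT.
apply: (C_narrow_strong_daugavet _ nsum) => //.
exact: continuous_seminormD (operator_seminorm (sum_operator bT cvgT)) sxs.
Qed.
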